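(* For each integer $k\geq 1$ there exist polynomials $p_k(t),q_k(t),z_k(t)\in\mathbb{Z}[t]$ such that for every matroid $\mathsf{M}$ of rank $k$ having a circuit-hyperplane $H$ the following equalities hold: \[ P_{\widetilde{\mathsf{M}}}(t)=P_{\mathsf{M}}(t)+p_k(t),\qquad Q_{\widetilde{\mathsf{M}}}(t)=Q_{\mathsf{M}}(t)+q_k(t),\qquad Z_{\widetilde{\mathsf{M}}}(t)=Z_{\mathsf{M}}(t)+z_k(t),\] where $\widetilde{\mathsf{M}}$ denotes the relaxation of $\mathsf{M}$ by $H$.
   Context: All matroids are finite. For a matroid $\mathsf{M}$ on ground set $E$ with rank function $\operatorname{rk}$, $\mathscr{L}(\mathsf{M})$ denotes the set of flats of $\mathsf{M}$. For a flat $F$, $\mathsf{M}^F$ is the restriction of $\mathsf{M}$ to $F$ (ground set $F$) and $\mathsf{M}_F$ is the contraction of $\mathsf{M}$ by $F$ (ground set $E\smallsetminus F$, rank function $A\mapsto \operatorname{rk}(A\cup F)-\operatorname{rk}(F)$). The characteristic polynomial is $\chi_{\mathsf{M}}(t)=\sum_{A\subseteq E}(-1)^{|A|}t^{\operatorname{rk}(\mathsf{M})-\operatorname{rk}(A)}$. The Kazhdan--Lusztig polynomial $P_{\mathsf{M}}(t)\in\mathbb{Z}[t]$ is the unique assignment of a polynomial to each matroid such that: (1) if $\operatorname{rk}(\mathsf{M})=0$ then $P_{\mathsf{M}}=1$ if $E=\varnothing$ and $P_{\mathsf{M}}=0$ otherwise; (2) if $\operatorname{rk}(\mathsf{M})>0$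 then $\deg P_{\mathsf{M}}<\operatorname{rk}(\mathsf{M})/2$; (3) $t^{\operatorname{rk}(\mathsf{M})}P_{\mathsf{M}}(t^{-1})=\sum_{F\in\mathscr{L}(\mathsf{M})}\chi_{\mathsf{M}^F}(t)P_{\mathsf{M}_F}(t)$. The inverse Kazhdan--Lusztig polynomial $Q_{\mathsf{M}}(t)\in\mathbb{Z}[t]$ is the unique assignment satisfying the same conditions (1) and (2) (with $Q$ in place of $P$) and (3') $(-t)^{\operatorname{rk}(\mathsf{M})}Q_{\mathsf{M}}(t^{-1})=\sum_{F\in\mathscr{L}(\mathsf{M})}(-1)^{\operatorname{rk}(F)}Q_{\mathsf{M}^F}(t)\,t^{\operatorname{rk}(\mathsf{M})-\operatorname{rk}(F)}\chi_{\mathsf{M}_F}(t^{-1})$. The $Z$-polynomial is $Z_{\mathsf{M}}(t)=\sum_{F\in\mathscr{L}(\mathsf{M})}t^{\operatorname{rk}(F)}P_{\mathsf{M}_F}(t)$. A circuit-hyperplane is a subset $H\subseteq E$ that is both a circuit and a hyperplane (flat of rank $\operatorname{rk}(\mathsf{M})-1$). The relaxation of $\mathsf{M}$ by $H$ is the matroid on $E$ whose set of bases is the set of bases of $\mathsf{M}$ together with $H$. *)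

(* Defs.v *)
From mathcomp Require Import all_boot all_order all_algebra.
From mathcomp Require Import zify ring.

Set Implicit Arguments.
Unset Strict Implicit.
Unset Printing Implicit Defensive.

Import GRing.Theory.

Local Open Scope nat_scope.

Section Matroids.
Variable T : finType.
Implicit Types (A B C E F G H : {set T}).

Definition rank_axioms E (r : {ffun {set T} -> nat}) : bool :=
  [&& [forall A : {set T}, r A <= #|A|],
      [forall A : {set T}, forall B : {set T}, (A \subset B) ==> (r A <= r B)],
      [forall A : {set T}, forall B : {set T},
         r (A :|: B) + r (A :&: B) <= r A + r B]
    & [forall A : {set T}, r (A :&: E) == r A]].

(* A matroid whose ground set is a subset of [T], given by its rank function.
   The rank function is extended to every subset of [T] by
   [r A = r (A :&: ground)]; with this normalization equality of matroids is
   Leibniz equality. *)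
Record matroid := Matroid {
  ground : {set T};
  rank_ffun : {ffun {set T} -> nat};
  matroidP : rank_axioms ground rank_ffun }.

Definition rk (M : matroid) A : nat := rank_ffun M A.
Definition rank (M : matroid) : nat := rk M (ground M).

Implicit Type M : matroid.

Lemma rk_card M A : rk M A <= #|A|.
Proof. by case/and4P: (matroidP M) => /forallP/(_ A). Qed.

Lemma rkS M A B : A \subset B -> rk M A <= rk M B.
Proof. by case/and4P: (matroidP M) => _ /forallP/(_ A)/forallP/(_ B)/implyP. Qed.

Lemma rk_submod M A B : rk M (A :|: B) + rk M (A :&: B) <= rk M A + rk M B.
Proof. by case/and4P: (matroidP M) => _ _ /forallP/(_ A)/forallP/(_ B). Qed.

Lemma rkI M A : rk M (A :&: ground M) = rk M A.
Proof. by case/and4P: (matroidP M) => _ _ _ /forallP/(_ A)/eqP. Qed.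

Lemma matroid_ext M N : ground M = ground N -> rk M =1 rk N -> M = N.
Proof.
case: M N => [E r rP] [E' r' rP'] /= EE' rr'.
have rE : r = r' by apply/ffunP => A; exact: rr'.
clear rr'; subst E' r'; by rewrite (bool_irrelevance rP rP').
Qed.

Lemma rank_axiomsP E (r : {set T} -> nat) :
    (forall A, r A <= #|A|) ->
    (forall A B, A \subset B -> r A <= r B) ->
    (forall A B, r (A :|: B) + r (A :&: B) <= r A + r B) ->
    (forall A, r (A :&: E) = r A) ->
  rank_axioms E [ffun A => r A].
Proof.
move=> r1 r2 r3 r4; apply/and4P; split.
- by apply/forallP => A; rewrite ffunE.
- by apply/forallP => A; apply/forallP => B; apply/implyP; rewrite !ffunE; apply: r2.
- by apply/forallP => A; apply/forallP => B; rewrite !ffunE.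
- by apply/forallP => A; rewrite !ffunE r4.
Qed.

Definition flat M F : bool :=
  (F \subset ground M) &&
  [forall x in ground M :\: F, rk M F < rk M (x |: F)].

Definition indep M A : bool := (A \subset ground M) && (rk M A == #|A|).

Definition bases M : {set {set T}} := [set B | maxset (indep M) B].

Definition circuit M C : bool :=
  minset [pred A : {set T} | (A \subset ground M) && ~~ indep M A] C.

Definition hyperplane M H : bool := flat M H && ((rk M H).+1 == rank M).

Definition circuit_hyperplane M H : bool := circuit M H && hyperplane M H.

Definition is_relaxation M H M' : Prop :=
  ground M' = ground M /\ bases M' = H |: bases M.

Lemma restr_axioms M F :
  rank_axioms (ground M :&: F) [ffun A => rk M (A :&: F)].
Proof.
apply: rank_axiomsP => [A|A B sAB|A B|A].
- by apply: leq_trans (rk_card M _) _; rewrite subset_leq_card // subsetIl.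
- by apply: rkS; rewrite setSI.
- by rewrite setIUl setIIl; apply: rk_submod.
- rewrite -[RHS]rkI; congr (rk M _); apply/setP => x.
  by rewrite !inE; do !case: (_ \in _).
Qed.

(* M^F, on the ground set F *)
Definition restr M F : matroid := Matroid (restr_axioms M F).

Lemma contr_axioms M F :
  rank_axioms (ground M :\: F) [ffun A => rk M (A :|: F) - rk M F].
Proof.
apply: rank_axiomsP => [A|A B sAB|A B|A].
- have := rk_submod M A F; have := rk_card M A; lia.
- by rewrite leq_sub2r // rkS // setSU.
- have := rk_submod M (A :|: F) (B :|: F).
  have -> : (A :|: F) :|: (B :|: F) = A :|: B :|: F
    by apply/setP => x; rewrite !inE; do !case: (_ \in _).
  have -> : (A :|: F) :&: (B :|: F) = A :&: B :|: F
    by apply/setP => x; rewrite !inE; do !case: (_ \in _).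
  have := rkS M (subsetUr (A :&: B) F); have := rkS M (subsetUr A F).
  have := rkS M (subsetUr B F); have := rkS M (subsetUr (A :|: B) F); lia.
- congr (_ - _); rewrite -rkI -[RHS]rkI; congr (rk M _); apply/setP => x.
  by rewrite !inE; do !case: (_ \in _).
Qed.

(* M_F, on the ground set E \ F *)
Definition contr M F : matroid := Matroid (contr_axioms M F).

End Matroids.

Local Open Scope ring_scope.

(* [t^n p(t^-1)], for a polynomial [p] of degree at most [n]. *)
Definition revp (n : nat) (p : {poly int}) : {poly int} :=
  \poly_(i < n.+1) p`_(n - i).

Section KLaxioms.
Variable T : finType.
Implicit Types (A B C E F G H : {set T}) (M : matroid T).

Definition charpoly M : {poly int} :=
  \sum_(A in powerset (ground M)) (-1) ^+ #|A| * 'X^(rank M - rk M A).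

Definition KL_normalized (P : matroid T -> {poly int}) : Prop :=
  (forall M, rank M = 0%N -> P M = (ground M == set0)%:R) /\
  (forall M, (0 < rank M)%N -> ((size (P M)).-1.*2 < rank M)%N).

Definition is_KL (P : matroid T -> {poly int}) : Prop :=
  KL_normalized P /\
  (forall M, revp (rank M) (P M) =
    \sum_(F | flat M F) charpoly (restr M F) * P (contr M F)).

Definition is_invKL (Q : matroid T -> {poly int}) : Prop :=
  KL_normalized Q /\
  (forall M, (-1) ^+ rank M * revp (rank M) (Q M) =
    \sum_(F | flat M F) (-1) ^+ rk M F * Q (restr M F)
                        * revp (rank M - rk M F)%N (charpoly (contr M F))).
End KLaxioms.

Module MatroidFacts.

Local Ltac setb := apply/setP => ?; rewrite !inE; do !case: (_ \in _).

Section Minors.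
Variable T : finType.
Implicit Types (A B C E F G H : {set T}) (M : matroid T).

Lemma rk_restr M F A : rk (restr M F) A = rk M (A :&: F).
Proof. by rewrite /rk ffunE. Qed.

Lemma rk_contr M F A : rk (contr M F) A = (rk M (A :|: F) - rk M F)%N.
Proof. by rewrite {1}/rk ffunE. Qed.

Lemma rk0 M : rk M set0 = 0%N.
Proof. by have := rk_card M set0; rewrite cards0; lia. Qed.

Lemma rk_le_rank M A : (rk M A <= rank M)%N.
Proof. by rewrite -rkI rkS // subsetIr. Qed.

Lemma rank_restr M F : rank (restr M F) = rk M F.
Proof. by rewrite /rank rk_restr /= -[RHS]rkI; congr rk; setb. Qed.

Lemma rank_contr M F : rank (contr M F) = (rank M - rk M F)%N.
Proof.
rewrite /rank rk_contr /=; congr (_ - _)%N.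
by rewrite -rkI; congr rk; setb.
Qed.

Lemma flat_sub M F : flat M F -> F \subset ground M.
Proof. by case/andP. Qed.

Lemma flatP M F : reflect (F \subset ground M /\
   forall x, x \in ground M -> x \notin F -> (rk M F < rk M (x |: F))%N) (flat M F).
Proof.
apply: (iffP andP) => -[sF]; first move/forall_inP; move=> h; split => //.
  by move=> x xE xF; apply: h; rewrite inE xF.
by apply/forall_inP => x; rewrite inE => /andP[xF xE]; apply: h.
Qed.

Lemma flat_ground M : flat M (ground M).
Proof. by apply/flatP; split => // x ->. Qed.

Lemma flat_restr M F G : flat M F ->
  flat (restr M F) G = (G \subset F) && flat M G.
Proof.
case/flatP => sF hF; apply/flatP/andP => /=.
  rewrite subsetI => -[/andP[sGE sGF] h]; split => //; apply/flatP; split=> // x xE xG.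
  have GF : G :&: F = G by apply/setIidPl.
  have [xF|xF] := boolP (x \in F).
    have := h x; rewrite inE xE xF xG !rk_restr GF => /(_ isT isT).
    by rewrite (setIidPl _) // subUset sub1set xF.
  have := hF _ xE xF; have := rk_submod M (x |: G) F.
  have -> : (x |: G) :|: F = x |: F by rewrite -setUA (setUidPr sGF).
  have -> : (x |: G) :&: F = G.
    rewrite setIUl GF (_ : [set x] :&: F = set0) ?set0U //.
    by apply/eqP; rewrite setI_eq0 disjoints1.
  lia.
case=> sGF /flatP[sGE hG]; rewrite subsetI sGE; split => // x.
rewrite inE => /andP[xE xF] xG; rewrite !rk_restr !(setIidPl _) //.
  exact: hG.
by rewrite subUset sub1set xF.
Qed.

Lemma flat_contr M G F : G \subset ground M ->
  flat (contr M G) F =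
  [&& F \subset ground M, [disjoint F & G] & flat M (F :|: G)].
Proof.
move=> sG; have rG A : (rk M G <= rk M (A :|: G))%N by rewrite rkS // subsetUr.
apply/flatP/and3P => /=; rewrite subsetD.
  move=> -[/andP[sF dF] h]; split => //; apply/flatP.
  rewrite subUset sF sG; split => // x xE.
  rewrite inE negb_or => /andP[xF xG].
  have := h x; rewrite inE xE xG xF !rk_contr => /(_ isT isT).
  by rewrite setUA; have := rG F; lia.
move=> [sF dF /flatP[_ h]]; rewrite sF dF; split => // x.
rewrite inE => /andP[xG xE] xF; rewrite !rk_contr.
have := h x xE; rewrite inE negb_or xF xG setUA => /(_ isT).
by have := rG F; lia.
Qed.

Lemma restr_ground M : restr M (ground M) = M.
Proof.
by apply: matroid_ext => [|A]; rewrite /= ?setIid // rk_restr rkI.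
Qed.

Lemma contr0 M : contr M set0 = M.
Proof.
by apply: matroid_ext => [|A]; rewrite /= ?setD0 // rk_contr rk0 subn0 setU0.
Qed.

Lemma restr_restr M F G : G \subset F -> restr (restr M F) G = restr M G.
Proof.
move=> sGF; apply: matroid_ext => [|A] /=.
  by rewrite -setIA (setIidPr sGF).
by rewrite !rk_restr -setIA (setIidPl sGF).
Qed.

Lemma contr_restr M F G : G \subset F ->
  contr (restr M F) G = restr (contr M G) (F :\: G).
Proof.
move=> sGF; apply: matroid_ext => [|A] /=; first by setb.
rewrite rk_restr !rk_contr !rk_restr (setIidPl sGF).
congr (rk M _ - _)%N.
apply/setP => x; rewrite !inE; have := subsetP sGF x.
by case: (x \in G) => [->//|_]; rewrite ?orbT ?orbF.
Qed.

Lemma contr_contr M F G : G \subset F -> contr (contr M G) (F :\: G) = contr M F.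
Proof.
move=> sGF; apply: matroid_ext => [|A] /=.
  apply/setP => x; rewrite !inE; have := subsetP sGF x.
  by case: (x \in G) => [->//|_].
have E1 : F :\: G :|: G = F.
  apply/setP => x; rewrite !inE; have := subsetP sGF x.
  by case: (x \in G) => [->//|_]; rewrite ?orbF.
rewrite !rk_contr -setUA E1.
have := rkS M sGF; have := rkS M (subsetUr A F); lia.
Qed.

Lemma flat0_contr M F : flat M F -> flat (contr M F) set0.
Proof.
move=> fF; rewrite (flat_contr _ (flat_sub fF)) sub0set set0U fF andbT.
by rewrite -setI_eq0 set0I eqxx.
Qed.

Lemma flat0_restr M F : flat M F -> flat (restr M F) set0 = flat M set0.
Proof. by move=> fF; rewrite flat_restr // sub0set. Qed.

Lemma loop_ex M : ~~ flat M set0 ->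
  exists2 x, x \in ground M & forall A, rk M (x |: A) = rk M A.
Proof.
rewrite /flat sub0set /= => /forall_inPn[x]; rewrite setD0 rk0 setU0 => xE r0.
exists x => // A; have := rk_submod M [set x] A; have := rkS M (subsetUr [set x] A).
lia.
Qed.

Lemma rkU_const M A B : (forall x, x \in B -> rk M (x |: A) = rk M A) ->
  rk M (A :|: B) = rk M A.
Proof.
move: {2}#|B| (erefl #|B|) => n.
elim: n B => [|n IHn] B; first by move/eqP; rewrite cards_eq0 => /eqP->; rewrite setU0.
move=> cB h; have /card_gt0P[x xB] : (0 < #|B|)%N by rewrite cB.
have IH : rk M (A :|: B :\ x) = rk M A.
  apply: IHn => [|y]; first by have := cardsD1 x B; rewrite xB; lia.
  by rewrite inE => /andP[_]; apply: h.
have := rk_submod M (x |: A) (A :|: B :\ x); rewrite IH h //.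
have -> : (x |: A) :|: (A :|: B :\ x) = A :|: B.
  apply/setP => y; rewrite !inE; have [->|_] /= := eqVneq y x; first by rewrite xB orbT.
  by do !case: (_ \in _).
have := rkS M (subsetUl A B).
have : (rk M A <= rk M ((x |: A) :&: (A :|: B :\ x)))%N.
  by apply: rkS; rewrite subsetI subsetUr subsetUl.
lia.
Qed.

Definition cl M A := [set x in ground M | rk M (x |: A) == rk M A].

Lemma cl_eq M A F : A \subset ground M -> flat M F ->
  (cl M A == F) = (A \subset F) && (rk M A == rk M F).
Proof.
move=> sA /flatP[sF hF].
have sAcl : A \subset cl M A.
  apply/subsetP => x xA; rewrite inE (subsetP sA) //=.
  by rewrite (setUidPr _) // sub1set.
have rcl : rk M (cl M A) = rk M A.
  rewrite -(setUidPr sAcl); apply: rkU_const => x.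
  by rewrite inE => /andP[_ /eqP].
apply/eqP/andP => [<-|[sAF /eqP rAF]]; first by rewrite sAcl rcl.
apply/setP => x; rewrite inE; apply/andP/idP => [[xE /eqP rx]|xF].
  have [//|xF] := boolP (x \in F).
  have := hF _ xE xF; have := rk_submod M (x |: A) F.
  rewrite -setUA (setUidPr sAF) => h1 h2.
  have : (rk M A <= rk M ((x |: A) :&: F))%N.
    by apply: rkS; rewrite subsetI sAF subsetUr.
  lia.
split; first exact: (subsetP sF).
rewrite eqn_leq (rkS M (subsetUr [set x] A)) andbT rAF rkS //.
by rewrite subUset sub1set xF.
Qed.

Lemma cl_flat M A : A \subset ground M -> flat M (cl M A).
Proof.
move=> sA.
have sAcl : A \subset cl M A.
  apply/subsetP => x xA; rewrite inE (subsetP sA) //=.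
  by rewrite (setUidPr _) // sub1set.
have rcl : rk M (cl M A) = rk M A.
  rewrite -(setUidPr sAcl); apply: rkU_const => x.
  by rewrite inE => /andP[_ /eqP].
apply/flatP; split=> [|x xE]; first by apply/subsetP => x; rewrite inE => /andP[].
rewrite inE xE /= => nx; rewrite rcl.
have : (rk M (x |: A) <= rk M (x |: cl M A))%N by apply: rkS; rewrite setUS.
have := rkS M (subsetUr [set x] A); move: nx; lia.
Qed.

Lemma sum_cl M (w : {set T} -> {poly int}) :
  \sum_(A in powerset (ground M)) w A =
  \sum_(F | flat M F) \sum_(A in powerset F | rk M A == rk M F) w A.
Proof.
rewrite (partition_big (cl M) (flat M)) /=; last first.
  by move=> A; rewrite powersetE; apply: cl_flat.
apply: eq_bigr => F fF; apply: eq_bigl => A; rewrite !powersetE.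
have [sA|nsA] := boolP (A \subset ground M); first by rewrite /= cl_eq.
rewrite /=; apply/esym/negbTE; apply: contra nsA => /andP[sAF _].
exact: subset_trans sAF (flat_sub fF).
Qed.

Lemma alt_sum0 E e (w : {set T} -> {poly int}) : e \in E ->
    (forall A, A \subset E -> w (e |: A) = w A) ->
  \sum_(A in powerset E) (-1) ^+ #|A| * w A = 0.
Proof.
move=> eE hw; rewrite (bigID (fun A => e \in A)) /= addrC.
apply/eqP; rewrite addr_eq0; apply/eqP; rewrite -sumrN.
rewrite [RHS](reindex_onto (fun A => e |: A) (fun A => A :\ e)) /=; last first.
  by move=> A /andP[_ eA]; rewrite setD1K.
apply: congr_big => // [A|A].
  rewrite !powersetE subUset sub1set eE setU11 /= andbT; congr (_ && _).
  apply/idP/eqP => [eA|<-]; last by rewrite setD11.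
  by rewrite setU1K.
case/andP; rewrite powersetE => sA eA.
by rewrite hw // cardsU1 eA exprS mulN1r mulNr opprK.
Qed.
End Minors.

Section Relax.
Variable T : finType.
Implicit Types (A B C E F G H : {set T}) (M : matroid T).

Lemma circuit_hyperplane_card M H : circuit_hyperplane M H ->
  [/\ #|H| = rank M, (rk M H).+1 = rank M, flat M H & forall A, A \proper H -> rk M A = #|A|].
Proof.
case/andP=> /minsetP[/andP[sH nH] hmin] /andP[fH /eqP rH].
have hp A : A \proper H -> rk M A = #|A|.
  move=> pA; have sA : A \subset ground M by apply: subset_trans (proper_sub pA) sH.
  have [/andP[_ /eqP//]|nA] := boolP (indep M A).
  have := hmin A; rewrite /= sA nA => /(_ isT (proper_sub pA)) eA.
  by rewrite eA properxx in pA.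
split => //; move: nH; rewrite /indep sH /= => nH; have := rk_card M H.
have [H0|/set0Pn[x xH]] := eqVneq H set0.
  by rewrite H0 rk0 cards0 in nH.
have := hp (H :\ x); rewrite properD1 // => /(_ isT).
have := cardsD1 x H; rewrite xH; have := rkS M (subD1set H x); lia.
Qed.

Lemma relax_axioms M H : circuit_hyperplane M H ->
  rank_axioms (ground M) [ffun A => (rk M A + (A :&: ground M == H))%N].
Proof.
move=> cH; have [cardH rH fH hp] := circuit_hyperplane_card cH.
have sH := flat_sub fH.
have rkE A : A :&: ground M = H -> rk M A = rk M H by move=> <-; rewrite rkI.
have big A : H \subset A -> A :&: ground M != H -> rk M A = rank M.
  move=> sHA nA; have /set0Pn[x] : (A :&: ground M) :\: H != set0.
    rewrite setD_eq0; apply: contra nA => s; rewrite eqEsubset s subsetI.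
    by rewrite sHA sH.
  rewrite !inE => /andP[xH /andP[xA xE]].
  have [_ /(_ x xE xH)] := flatP _ _ fH.
  have : (rk M (x |: H) <= rk M A)%N by rewrite rkS // subUset sub1set xA.
  have := rk_le_rank M A; lia.
have small A : A :&: ground M \subset H -> A :&: ground M != H ->
    rk M A = #|A :&: ground M|.
  by move=> s n; rewrite -rkI; apply: hp; rewrite properEneq n.
have cardI A : (#|A :&: ground M| <= #|A|)%N by rewrite subset_leq_card // subsetIl.
apply: rank_axiomsP => [A|A B sAB|A B|A].
- have [e|_] := eqVneq; last by rewrite addn0 rk_card.
  by rewrite rkE // addn1 rH -cardH -e.
- have := rkS M sAB; have [e|_] := eqVneq; last by lia.
  have [eB|nB] := eqVneq (B :&: ground M) H; first by lia.
  have sHB : H \subset B by apply: subset_trans sAB; rewrite -e subsetIl.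
  by rewrite rkE // (big B) //; lia.
- have sub := rk_submod M A B.
  have [eU|nU] := eqVneq ((A :|: B) :&: ground M) H.
    have sA : A :&: ground M \subset H by rewrite -eU setSI // subsetUl.
    have sB : B :&: ground M \subset H by rewrite -eU setSI // subsetUr.
    have rU : rk M (A :|: B) = rk M H by rewrite rkE.
    have [eA|nA] := eqVneq (A :&: ground M) H.
      have -> : ((A :&: B) :&: ground M == H) = (B :&: ground M == H).
        by rewrite setIIl eA (setIidPr sB).
      by move: sub; case: (B :&: ground M == H); lia.
    have [eB|nB] := eqVneq (B :&: ground M) H.
      have -> : ((A :&: B) :&: ground M == H) = false.
        apply/negbTE; apply: contra nA => /eqP e; rewrite eqEsubset sA -e.
        by rewrite setSI // subsetIl.
      move: sub; lia.
    have -> : ((A :&: B) :&: ground M == H) = false.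
      apply/negbTE; apply: contra nA => /eqP e; rewrite eqEsubset sA -e.
      by rewrite setSI // subsetIl.
    have := small _ sA nA; have := small _ sB nB.
    have := cardsUI (A :&: ground M) (B :&: ground M).
    rewrite -setIUl -setIIl eU cardH.
    have : (rk M (A :&: B) <= #|A :&: B :&: ground M|)%N by rewrite -rkI rk_card.
    by move: sub rU; lia.
  have [eI|nI] := eqVneq ((A :&: B) :&: ground M) H; last by move: sub; lia.
  have sA : H \subset A by rewrite -eI -setIA subsetIl.
  have sB : H \subset B by rewrite -eI setIAC subsetIr.
  have rU := big _ (subset_trans sA (subsetUl A B)) nU.
  have rI : rk M (A :&: B) = rk M H by rewrite rkE.
  have rA : (rk M A + (A :&: ground M == H))%N = rank M.
    by have [e|n] := eqVneq; rewrite ?(rkE _ e) ?(big _ sA n) //; lia.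
  have rB : (rk M B + (B :&: ground M == H))%N = rank M.
    by have [e|n] := eqVneq; rewrite ?(rkE _ e) ?(big _ sB n) //; lia.
  rewrite rA rB rU rI; lia.
- by rewrite rkI -setIA setIid.
Qed.

Lemma basesE M B : (B \in bases M) = indep M B && (#|B| == rank M).
Proof.
rewrite inE; apply/maxsetP/andP => [[/andP[sB /eqP rB] hmax]|[/andP[sB /eqP rB] /eqP cB]].
  rewrite /indep sB rB eqxx; split => //; rewrite -rB.
  rewrite -[X in X == _](rkU_const (B := ground M)) ?(setUidPr sB) // => x xE.
  have [xB|xB] := boolP (x \in B); first by rewrite (setUidPr _) // sub1set.
  apply/eqP; rewrite eqn_leq (rkS M (subsetUr [set x] B)) andbT leqNgt; apply/negP => lt.
  have c1 : #|x |: B| = #|B|.+1 by rewrite cardsU1 xB.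
  have := hmax (x |: B); rewrite /indep subUset sub1set xE sB subsetUr /=.
  have := rk_card M (x |: B); rewrite c1 => le1.
  have -> : rk M (x |: B) == #|B|.+1 by lia.
  by move=> /(_ isT isT) e; rewrite -e setU11 in xB.
split=> [|C /andP[sC /eqP rC] sBC]; first by rewrite /indep sB rB /=.
apply/eqP; rewrite eq_sym eqEcard sBC -rC cB; exact: rk_le_rank.
Qed.

Lemma relaxation_exists M H : circuit_hyperplane M H ->
  {M' | is_relaxation M H M'}.
Proof.
move=> cH; exists (Matroid (relax_axioms cH)); split => //.
have [cardH rH fH hp] := circuit_hyperplane_card cH.
have sH := flat_sub fH.
set M' := Matroid _.
have rkM' A : rk M' A = (rk M A + (A :&: ground M == H))%N by rewrite /rk ffunE.
have nEH : ground M != H by apply: contraTneq isT => e; move: rH; rewrite /rank e; lia.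
have rM' : rank M' = rank M by rewrite /rank rkM' setIid (negbTE nEH) addn0.
apply/setP => B; rewrite in_setU1 !basesE rM' /indep rkM' /=.
have [sB|nsB] := boolP (B \subset ground M); last first.
  by have [e|//] := eqVneq B H; rewrite e sH in nsB.
rewrite (setIidPl sB) /=; have [->|_] := eqVneq B H; last by rewrite addn0.
by rewrite addn1 rH cardH eqxx.
Qed.
End Relax.

Section Revp.
Implicit Types (p q S : {poly int}).

Lemma coef_ge p i : (size p <= i)%N -> p`_i = 0.
Proof. exact: nth_default. Qed.

Lemma coef_revp n p i : (revp n p)`_i = if (i <= n)%N then p`_(n - i) else 0.
Proof. by rewrite coef_poly ltnS. Qed.

Lemma size_revp n p : (size (revp n p) <= n.+1)%N.
Proof. exact: size_poly. Qed.

Lemma revpD n p q : revp n (p + q) = revp n p + revp n q.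
Proof. by apply/polyP => i; rewrite coefD !coef_revp coefD; case: ifP; rewrite ?addr0. Qed.

Lemma revp0 n : revp n 0 = 0.
Proof. by apply/polyP => i; rewrite coef_revp !coef0 if_same. Qed.

Lemma revp_sum n (I : Type) (r : seq I) (P : pred I) (f : I -> {poly int}) :
  revp n (\sum_(i <- r | P i) f i) = \sum_(i <- r | P i) revp n (f i).
Proof. exact: (big_morph (revp n) (revpD n) (revp0 n)). Qed.

Lemma revpZ n (c : int) p : revp n (c *: p) = c *: revp n p.
Proof. by apply/polyP => i; rewrite coefZ !coef_revp coefZ; case: ifP; rewrite ?mulr0. Qed.

Lemma revpXn n i : (i <= n)%N -> revp n 'X^i = 'X^(n - i).
Proof.
move=> le_in; apply/polyP => j; rewrite coef_revp !coefXn.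
case: ifP => h; first by congr (nat_of_bool _)%:R; lia.
by have -> : (j == n - i)%N = false by lia.
Qed.

Lemma revpM m n p q : (size p <= m.+1)%N -> (size q <= n.+1)%N ->
  revp (m + n) (p * q) = revp m p * revp n q.
Proof.
have expand k (r : {poly int}) : (size r <= k.+1)%N ->
    r = \sum_(i < k.+1) r`_i *: 'X^i.
  move=> sr; rewrite -poly_def; apply/polyP => i; rewrite coef_poly.
  by case: ifP => // h; rewrite nth_default // (leq_trans sr) // leqNgt h.
move=> /expand -> /expand ->.
rewrite mulr_suml !revp_sum mulr_suml; apply: eq_bigr => i _.
rewrite !mulr_sumr !revp_sum; apply: eq_bigr => j _.
have := ltn_ord i; have := ltn_ord j => hj hi.
rewrite -scalerAl -scalerAr -exprD !revpZ !revpXn; try lia.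
rewrite -scalerAl -scalerAr -exprD; congr (_ *: (_ *: 'X^_)); lia.
Qed.

Lemma revpK n p : (size p <= n.+1)%N -> revp n (revp n p) = p.
Proof.
move=> sp; apply/polyP => i; rewrite !coef_revp; case: ifP => h.
  by rewrite leq_subr; congr (_`_ _); lia.
by rewrite nth_default // (leq_trans sp) // ltnNge h.
Qed.

Definition lowp k S : {poly int} := \poly_(i < uphalf k) S`_(k - i).

Lemma size_lowp k S : (0 < k)%N -> ((size (lowp k S)).-1.*2 < k)%N.
Proof.
move=> k0; have := size_poly (uphalf k) (fun i => S`_(k - i)).
rewrite -/(lowp k S); have := uphalf_half k; have := odd_double_half k; lia.
Qed.

Lemma revp_lowp k S : (size S <= k.+1)%N -> S + revp k S = 0 ->
  revp k (lowp k S) = lowp k S + S.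
Proof.
move=> sS h; have hc i : (i <= k)%N -> S`_i = - S`_(k - i).
  move=> ik; apply/eqP; rewrite -addr_eq0; apply/eqP.
  by have := congr1 (fun p : {poly int} => p`_i) h; rewrite coefD coef_revp ik coef0.
have ku := uphalf_half k; have ko := odd_double_half k.
apply/polyP => i; rewrite coefD coef_revp !coef_poly.
case: (leqP i k) => ik; last first.
  rewrite [S`_i]nth_default ?(leq_trans sS) // addr0.
  by have -> : (i < uphalf k)%N = false by lia.
have -> : (k - (k - i) = i)%N by lia.
case: ifP => h1; case: ifP => h2.
- lia.
- by rewrite add0r.
- by rewrite [in RHS](hc i ik) subrr.
- rewrite add0r; have e : (k - i = i)%N by lia.
  have := hc i ik; rewrite e; lia.
Qed.

Lemma low_uniq k p q : (0 < k)%N -> ((size p).-1.*2 < k)%N -> ((size q).-1.*2 < k)%N ->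
  revp k p - p = revp k q - q -> p = q.
Proof.
move=> k0 sp sq e; apply/polyP => i.
have [hi|hi] := leqP k i.*2; first by rewrite !coef_ge //; lia.
have := congr1 (fun p : {poly int} => p`_(k - i)) e.
rewrite !coefB !coef_revp leq_subr.
have -> : (k - (k - i) = i)%N by lia.
rewrite [p`_(k - i)]coef_ge ?[q`_(k - i)]coef_ge ?subr0 //; lia.
Qed.
End Revp.

Section Conv.
Variable T : finType.
Implicit Types (A B C E F G H : {set T}) (M : matroid T).
Implicit Types f g h : matroid T -> {poly int}.

Definition conv f g M : {poly int} :=
  \sum_(F | flat M F) f (restr M F) * g (contr M F).

Lemma eq_conv f f' g g' : f =1 f' -> g =1 g' -> conv f g =1 conv f' g'.
Proof. by move=> ef eg M; apply: eq_bigr => F _; rewrite ef eg. Qed.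

Lemma convA f g h : conv f (conv g h) =1 conv (conv f g) h.
Proof.
move=> M; rewrite /conv.
under eq_bigr do rewrite mulr_sumr.
under [RHS]eq_bigr do rewrite mulr_suml.
rewrite [RHS](exchange_big_dep (flat M)) /=; last first.
  by move=> F G fF; rewrite flat_restr // => /andP[].
apply: eq_bigr => G fG.
rewrite [RHS](reindex_onto (fun F => F :|: G) (fun F => F :\: G)) /=; last first.
  move=> F /andP[fF]; rewrite flat_restr // => /andP[sGF _].
  apply/setP => x; rewrite !inE; have := subsetP sGF x.
  by case: (x \in G) => [->//|_]; rewrite ?orbF.
apply: congr_big => // [F|F].
  rewrite (flat_contr _ (flat_sub fG)).
  have -> : ((F :|: G) :\: G == F) = [disjoint F & G].
    by rewrite setDUl setDv setU0; apply/eqP/setDidPl.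
  have [fU|] := boolP (flat M (F :|: G)); last by rewrite !andbF.
  rewrite flat_restr // subsetUr fG !andbT /=.
  by rewrite (subset_trans (subsetUl F G) (flat_sub fU)).
rewrite (flat_contr _ (flat_sub fG)) => /and3P[_ dF fU].
have sGU := subsetUr F G.
have eF : F = (F :|: G) :\: G.
  by rewrite setDUl setDv setU0; apply/esym/setDidPl.
by rewrite {1 2}eF contr_contr // -contr_restr // restr_restr // mulrA.
Qed.

Definition deltam M : {poly int} := (ground M == set0)%:R.
Definition zetam M : {poly int} := (flat M set0)%:R.
Definition zetat M : {poly int} := (flat M set0)%:R * 'X^(rank M).
Definition mum M : {poly int} :=
  \sum_(A in powerset (ground M) | rk M A == rank M) (-1) ^+ #|A|.
Definition rev f M := revp (rank M) (f M).
Definition bdd f := forall M, (size (f M) <= (rank M).+1)%N.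

Lemma rank_ground0 M : ground M = set0 -> rank M = 0%N.
Proof. by move=> e; rewrite /rank e rk0. Qed.

Lemma ground_contr0 M F : flat M F -> (ground (contr M F) == set0) = (F == ground M).
Proof. by move=> /flat_sub sF; rewrite /= setD_eq0 eqEsubset sF. Qed.

Lemma ground_restr0 M F : flat M F -> (ground (restr M F) == set0) = (F == set0).
Proof. by move=> /flat_sub sF; rewrite /= (setIidPr sF). Qed.

Lemma conv_delta f M : conv f deltam M = f M.
Proof.
rewrite /conv (bigD1 (ground M)) ?flat_ground //= big1 => [|F /andP[fF nF]].
  by rewrite /deltam ground_contr0 ?flat_ground // eqxx mulr1 addr0 restr_ground.
by rewrite /deltam ground_contr0 // (negbTE nF) mulr0.
Qed.

Lemma delta_conv f M : conv deltam f M = if flat M set0 then f M else 0.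
Proof.
rewrite /conv; case: ifP => f0; last first.
  apply: big1 => F fF; rewrite /deltam ground_restr0 //.
  by case: eqP fF f0 => [-> ->//|_ _ _]; rewrite mul0r.
rewrite (bigD1 set0) //= big1 => [|F /andP[fF nF]].
  by rewrite /deltam ground_restr0 // eqxx mul1r addr0 contr0.
by rewrite /deltam ground_restr0 // (negbTE nF) mul0r.
Qed.

Lemma rank_add M F : flat M F -> (rank (restr M F) + rank (contr M F))%N = rank M.
Proof. by move=> fF; rewrite rank_restr rank_contr; have := rk_le_rank M F; lia. Qed.

Lemma rev_conv f g : bdd f -> bdd g -> rev (conv f g) =1 conv (rev f) (rev g).
Proof.
move=> bf bg M; rewrite /rev /conv revp_sum; apply: eq_bigr => F fF.
by rewrite -revpM // rank_add.
Qed.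

Lemma bdd_conv f g : bdd f -> bdd g -> bdd (conv f g).
Proof.
move=> bf bg M; apply: (big_ind (fun p : {poly int} => size p <= (rank M).+1)%N).
- by rewrite size_poly0.
- by move=> p q sp sq; apply: leq_trans (size_polyD _ _) _; rewrite geq_max sp.
move=> F fF; apply: leq_trans (size_polyMleq _ _) _.
by have := bf (restr M F); have := bg (contr M F); rewrite -(rank_add fF); lia.
Qed.

Lemma charpoly_conv : charpoly (T:=T) =1 conv mum zetat.
Proof.
move=> M; rewrite /charpoly sum_cl; apply: eq_bigr => F fF.
rewrite /mum /zetat flat0_contr // mul1r rank_contr rank_restr mulr_suml.
rewrite /= (setIidPr (flat_sub fF)).
apply: congr_big => // [A|A]; last by case/andP=> _ /eqP->.
rewrite powersetE; have [sAF|//] := boolP (A \subset F).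
by rewrite rk_restr (setIidPl sAF).
Qed.

Lemma mu_zeta : conv mum zetam =1 deltam.
Proof.
move=> M.
have -> : conv mum zetam M = \sum_(A in powerset (ground M)) (-1) ^+ #|A| * 1.
  rewrite sum_cl; apply: eq_bigr => F fF.
  rewrite /zetam flat0_contr // mulr1 /mum rank_restr /= (setIidPr (flat_sub fF)).
  apply: congr_big => // [A|A]; last by rewrite mulr1.
  rewrite powersetE; have [sAF|//] := boolP (A \subset F).
  by rewrite rk_restr (setIidPl sAF).
rewrite /deltam; have [->|/set0Pn[e eE]] := eqVneq (ground M) set0.
  by rewrite powerset0 big_set1 cards0 mulr1.
by rewrite (alt_sum0 eE).
Qed.

Lemma mum_loop M : ~~ flat M set0 -> mum M = 0.
Proof.
case/loop_ex => e eE he.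
rewrite /mum.
transitivity (\sum_(A in powerset (ground M)) (-1) ^+ #|A| * (rk M A == rank M)%:R : {poly int}).
  rewrite big_mkcondr; apply: eq_bigr => A _.
  by case: ifP; rewrite ?mulr1 ?mulr0.
by apply: alt_sum0 eE _ => A _; rewrite he.
Qed.

Lemma charpoly_loop M : ~~ flat M set0 -> charpoly M = 0.
Proof.
case/loop_ex => e eE he; rewrite /charpoly.
by apply: (alt_sum0 (w := fun A => 'X^(rank M - rk M A)) eE) => A _; rewrite he.
Qed.

Lemma mum_const M : exists c : int, mum M = c%:P.
Proof.
exists (\sum_(A in powerset (ground M) | rk M A == rank M) (-1) ^+ #|A|).
rewrite rmorph_sum; apply: eq_bigr => A _; by rewrite rmorphXn rmorphN1.
Qed.

Lemma rev_mum M : rev mum M = mum M * 'X^(rank M).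
Proof.
rewrite /rev; case: (mum_const M) => c ->.
by rewrite -[c%:P]mulr1 mul_polyC revpZ -[1](expr0 'X) revpXn // subn0 -scalerAl mul1r.
Qed.

Lemma rev_zetat : rev zetat =1 zetam.
Proof.
move=> M; rewrite /rev /zetat /zetam; case: flat; last by rewrite mul0r revp0.
by rewrite mul1r revpXn // subnn.
Qed.

Lemma bdd_mum : bdd mum.
Proof. by move=> M; case: (mum_const M) => c ->; apply: leq_trans (size_polyC_leq1 _) _. Qed.

Lemma bdd_zetat : bdd zetat.
Proof.
move=> M; rewrite /zetat; case: flat; last by rewrite mul0r size_poly0.
by rewrite mul1r size_polyXn.
Qed.

Lemma bdd_charpoly : bdd (charpoly (T:=T)).
Proof. by move=> M; rewrite charpoly_conv; apply: (bdd_conv bdd_mum bdd_zetat). Qed.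

Lemma zeta_mu : conv zetam mum =1 deltam.
Proof.
have ez : conv (conv zetam mum) zetam =1 zetam.
  move=> M; rewrite -convA (eq_conv (g' := deltam) (fun=> erefl) mu_zeta).
  exact: conv_delta.
move=> M; move: {2}#|ground M|.+1 (ltnSn #|ground M|) => n.
elim: n M => // n IHn M ltM.
have [f0|nf0] := boolP (flat M set0); last first.
  rewrite /conv big1 => [|F fF]; last by rewrite /zetam flat0_restr // (negbTE nf0) mul0r.
  rewrite /deltam; have [e|//] := eqVneq (ground M) set0.
  by rewrite -e flat_ground in nf0.
have := ez M; rewrite {1}/conv (bigD1 (ground M)) ?flat_ground //=.
rewrite restr_ground [zetam (contr _ _)]/zetam flat0_contr ?flat_ground // mulr1.
set s := \sum_(F | _) _.
have -> : s = (ground M != set0)%:R.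
  have -> : s = \sum_(F | flat M F && (F != ground M)) deltam (restr M F) .
    apply: eq_bigr => F /andP[fF nF].
    rewrite [zetam (contr _ _)]/zetam flat0_contr // mulr1 IHn //=.
    rewrite (setIidPr (flat_sub fF)).
    have : (#|F| < #|ground M|)%N by apply: proper_card; rewrite properEneq nF flat_sub.
    by move: ltM; lia.
  have [e|ne] := eqVneq (ground M) set0.
    rewrite big_pred0 // => F; apply/negbTE; rewrite negb_and orbC negbK.
    have [/flat_sub|] := boolP (flat M F); last by rewrite orbT.
    by rewrite e subset0 => /eqP->; rewrite eqxx.
  rewrite (bigD1 set0) /=; last by rewrite f0 eq_sym.
  rewrite /deltam ground_restr0 // eqxx big1 ?addr0 // => F /andP[/andP[fF _] nF].
  by rewrite ground_restr0 // (negbTE nF).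
rewrite /zetam f0 /deltam; case: (ground M == set0) => /=; first by rewrite addr0.
by move/eqP; rewrite -subr_eq0 addrK => /eqP.
Qed.

Lemma charpoly_kernel : conv (rev (charpoly (T:=T))) (charpoly (T:=T)) =1 deltam.
Proof.
have e1 : rev (charpoly (T:=T)) =1 conv (rev mum) zetam.
  move=> M; rewrite /rev charpoly_conv.
  rewrite -[LHS]/(rev (conv mum zetat) M) rev_conv; [|exact: bdd_mum|exact: bdd_zetat].
  exact: eq_conv rev_zetat _.
have e2 : conv zetam (conv mum zetat) =1 zetat.
  move=> M; rewrite convA (eq_conv (g' := zetat) zeta_mu) // delta_conv /zetat.
  by case: (flat M set0); rewrite ?mul0r.
move=> M; rewrite (eq_conv e1 charpoly_conv) -convA (eq_conv (f' := rev mum) _ e2) //.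
have -> : conv (rev mum) zetat M = conv mum zetam M * 'X^(rank M).
  rewrite /conv mulr_suml; apply: eq_bigr => F fF.
  by rewrite rev_mum /zetat /zetam flat0_contr // mul1r mulr1 -mulrA -exprD rank_add.
rewrite mu_zeta /deltam; case: eqP => [/rank_ground0->|_]; first by rewrite mulr1.
by rewrite mul0r.
Qed.
End Conv.

Section Exist.
Variable T : finType.
Implicit Types (A B C E F G H : {set T}) (M : matroid T).
Implicit Types (P Q f g : matroid T -> {poly int}).
Let chi := charpoly (T := T).

Lemma charpoly_ground0 M : ground M = set0 -> chi M = 1.
Proof.
move=> e; rewrite /chi /charpoly e powerset0 big_set1 cards0 rank_ground0 //.
by rewrite expr0 mul1r.
Qed.

Lemma rev_charpoly_ground0 M : ground M = set0 -> rev chi M = 1.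
Proof.
by move=> e; rewrite /rev charpoly_ground0 // rank_ground0 // -(expr0 'X) revpXn.
Qed.

Lemma ground_contr_lt M F : flat M F -> F != set0 -> (#|ground (contr M F)| < #|ground M|)%N.
Proof.
move=> /flat_sub sF nF; have := cardsID F (ground M); rewrite (setIidPr sF) /=.
move: nF; rewrite -card_gt0; lia.
Qed.

Lemma ground_restr_lt M F : flat M F -> F != ground M -> (#|ground (restr M F)| < #|ground M|)%N.
Proof.
move=> /flat_sub sF nF; rewrite /= (setIidPr sF).
by apply: proper_card; rewrite properEneq nF.
Qed.

Lemma ground_contr_le M F : (#|ground (contr M F)| <= #|ground M|)%N.
Proof. by rewrite subset_leq_card // subsetDl. Qed.

Lemma ground_restr_le M F : (#|ground (restr M F)| <= #|ground M|)%N.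
Proof. by rewrite subset_leq_card // subsetIl. Qed.

Lemma normalized_bdd P : KL_normalized P -> bdd P.
Proof.
case=> P0 P1 M; have [r0|r0] := posnP (rank M); last by have := P1 M r0; lia.
by rewrite P0 // r0; case: eqP; rewrite ?size_poly1 ?size_poly0.
Qed.

Definition sumP P M := \sum_(F | flat M F && (F != set0)) chi (restr M F) * P (contr M F).
Definition sumQ g M := \sum_(F | flat M F && (F != ground M)) g (restr M F) * rev chi (contr M F).

Definition cut n f M := if (#|ground M| < n)%N then f M else 0.

Lemma conv_sumP P M : flat M set0 -> conv chi P M = P M + sumP P M.
Proof.
move=> f0; rewrite /conv (bigD1 set0) //= charpoly_ground0 /= ?setI0 //.
by rewrite mul1r contr0.
Qed.

Lemma conv_sumQ g M : conv g (rev chi) M = g M + sumQ g M.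
Proof.
rewrite /conv (bigD1 (ground M)) ?flat_ground //= rev_charpoly_ground0 /= ?setDv //.
by rewrite mulr1 restr_ground.
Qed.

Lemma bdd_cut n f : bdd f -> bdd (cut n f).
Proof. by move=> bf M; rewrite /cut; case: ifP; rewrite ?size_poly0. Qed.

Lemma bdd_rev f : bdd (rev f).
Proof. by move=> M; apply: size_revp. Qed.

Lemma revK f : bdd f -> rev (rev f) =1 f.
Proof. by move=> bf M; apply: revpK. Qed.

Lemma cut_self f M : cut #|ground M| f M = 0.
Proof. by rewrite /cut ltnn. Qed.

Lemma sumP_anti P M : bdd P -> flat M set0 ->
    (forall N, (#|ground N| < #|ground M|)%N -> rev P N = conv chi P N) ->
  (size (sumP P M) <= (rank M).+1)%N /\ sumP P M + revp (rank M) (sumP P M) = 0.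
Proof.
move=> bP f0 IH; set f := cut #|ground M| P.
have bf : bdd f by apply: bdd_cut.
have fM : f M = 0 by apply: cut_self.
have rfM : rev f M = 0 by rewrite /rev fM revp0.
have eS : sumP P M = conv chi f M.
  rewrite conv_sumP // fM add0r; apply: eq_bigr => F /andP[fF nF].
  by rewrite /f /cut ground_contr_lt.
have bchi : bdd chi by apply: bdd_charpoly.
split; first by rewrite eS; apply: bdd_conv.
have IHf N : (#|ground N| < #|ground M|)%N -> conv chi f N = rev f N.
  move=> ltN; rewrite /rev {2}/f /cut ltN -/(rev P N) IH //.
  apply: eq_bigr => F fF; rewrite /f /cut.
  by rewrite (leq_ltn_trans (ground_contr_le N F) ltN).
have := convA (rev chi) chi f M.
rewrite (eq_conv (g' := f) (@charpoly_kernel T)) // delta_conv f0 fM.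
rewrite {1}/conv (bigD1 set0) //= rev_charpoly_ground0 /= ?setI0 //.
rewrite mul1r contr0 -eS => <-; congr (_ + _).
rewrite eS -[LHS]/(rev (conv chi f) M) rev_conv // /conv (bigD1 set0) //=.
rewrite contr0 rfM mulr0 add0r; apply: eq_bigr => F /andP[fF nF].
by rewrite -[X in _ * X]IHf // ground_contr_lt.
Qed.

Lemma sumQ_anti g M : bdd g ->
    (forall N, (#|ground N| < #|ground M|)%N -> rev g N = conv g (rev chi) N) ->
  (size (sumQ g M) <= (rank M).+1)%N /\ sumQ g M + revp (rank M) (sumQ g M) = 0.
Proof.
move=> bg IH; set f := cut #|ground M| g.
have bf : bdd f by apply: bdd_cut.
have fM : f M = 0 by apply: cut_self.
have rfM : rev f M = 0 by rewrite /rev fM revp0.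
have eS : sumQ g M = conv f (rev chi) M.
  rewrite conv_sumQ // fM add0r; apply: eq_bigr => F /andP[fF nF].
  by rewrite /f /cut ground_restr_lt.
have bchi : bdd chi by apply: bdd_charpoly.
have brchi : bdd (rev chi) by apply: bdd_rev.
split; first by rewrite eS; apply: bdd_conv.
have IHf N : (#|ground N| < #|ground M|)%N -> conv f (rev chi) N = rev f N.
  move=> ltN; rewrite /rev {2}/f /cut ltN -/(rev g N) IH //.
  apply: eq_bigr => F fF; rewrite /f /cut.
  by rewrite (leq_ltn_trans (ground_restr_le N F) ltN).
have := convA f (rev chi) chi M.
rewrite (eq_conv (f' := f) _ (@charpoly_kernel T)) // conv_delta fM.
rewrite [X in _ = X -> _]/conv (bigD1 (ground M)) ?flat_ground //=.
rewrite charpoly_ground0 /= ?setDv //.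
rewrite mulr1 restr_ground -eS => ->; congr (_ + _).
rewrite eS -[LHS]/(rev (conv f (rev chi)) M) rev_conv // /conv.
rewrite (bigD1 (ground M)) ?flat_ground //=.
rewrite restr_ground rfM mul0r add0r; apply: eq_bigr => F /andP[fF nF].
by rewrite revK // -[X in X * _]IHf // ground_restr_lt.
Qed.

Fixpoint klf n M : {poly int} :=
  if n is n'.+1 then
    if rank M == 0%N then (ground M == set0)%:R
    else if flat M set0 then lowp (rank M) (sumP (klf n') M) else 0
  else 0.

Fixpoint iklf n M : {poly int} :=
  if n is n'.+1 then
    if rank M == 0%N then (ground M == set0)%:R
    else lowp (rank M) (sumQ (iklf n') M)
  else 0.

Lemma klf_fuel n m M : (#|ground M| < n)%N -> (#|ground M| < m)%N -> klf n M = klf m M.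
Proof.
elim: n m M => // n IHn [//|m] M ln lm /=; case: ifP => // _; case: ifP => // _.
congr lowp; apply: eq_bigr => F /andP[fF nF]; congr (_ * _).
by have := ground_contr_lt fF nF => lt; apply: IHn; move: lt ln lm; lia.
Qed.

Lemma iklf_fuel n m M : (#|ground M| < n)%N -> (#|ground M| < m)%N -> iklf n M = iklf m M.
Proof.
elim: n m M => // n IHn [//|m] M ln lm /=; case: ifP => // _.
congr lowp; apply: eq_bigr => F /andP[fF nF]; congr (_ * _).
by have := ground_restr_lt fF nF => lt; apply: IHn; move: lt ln lm; lia.
Qed.

Lemma KL_assignment_exists : {P : matroid T -> {poly int} | is_KL P}.
Proof.
pose P M := klf #|ground M|.+1 M.
have PE M : P M = if rank M == 0%N then (ground M == set0)%:R
    else if flat M set0 then lowp (rank M) (sumP P M) else 0.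
  rewrite {1}/P /=; case: ifP => // _; case: ifP => // _.
  congr lowp; apply: eq_bigr => F /andP[fF nF]; congr (_ * _).
  by apply: klf_fuel => //; apply: ground_contr_lt.
have nP : KL_normalized P.
  split=> M r0; rewrite PE; first by rewrite r0.
  rewrite (gtn_eqF r0) /=; case: ifP => _; first exact: size_lowp.
  by rewrite size_poly0.
exists P; split => //.
suff main M : rev P M = conv chi P M by [].
have bP := normalized_bdd nP.
move: {2}#|ground M|.+1 (ltnSn #|ground M|) => n; elim: n M => // n IHn M ltM.
have [f0|nf0] := boolP (flat M set0); last first.
  rewrite /conv big1 => [|F fF]; last by rewrite [chi _]charpoly_loop ?flat0_restr // mul0r.
  rewrite /rev PE (negbTE nf0); case: eqP => _; last by rewrite revp0.
  have [e|_] := eqVneq (ground M) set0; last by rewrite revp0.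
  by rewrite -e flat_ground in nf0.
have [|sS aS] := sumP_anti bP f0.
  by move=> N ltN; apply: IHn; move: ltN ltM; lia.
rewrite conv_sumP // /rev.
have [r0|r0] := posnP (rank M); last first.
  by rewrite {1 2}PE (gtn_eqF r0) /= f0; apply: revp_lowp.
have nl : #|ground M| = 0%N.
  apply/eqP; rewrite cards_eq0; apply/negPn; apply/negP => /set0Pn[x xE].
  have [_ /(_ x xE)] := flatP _ _ f0; rewrite in_set0 rk0 => /(_ isT).
  by have := rk_le_rank M (x |: set0); rewrite r0; lia.
have g0 : ground M = set0 by apply/eqP; rewrite -cards_eq0 nl.
rewrite [sumP _ _]big_pred0 => [|F]; last first.
  apply/negbTE; rewrite negb_and negbK; have [/flat_sub|//] := boolP (flat M F).
  by rewrite g0 subset0 => /eqP->; rewrite eqxx orbT.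
by rewrite PE r0 eqxx g0 eqxx addr0 -(expr0 'X) revpXn.
Qed.

Lemma invKL_conv Q M :
  \sum_(F | flat M F) (-1) ^+ rk M F * Q (restr M F)
                    * revp (rank M - rk M F) (chi (contr M F))
  = conv (fun N => (-1) ^+ rank N * Q N) (rev chi) M.
Proof.
by apply: eq_bigr => F fF; rewrite /rev rank_contr rank_restr.
Qed.

Lemma revp_sign n k p : revp n ((-1) ^+ k * p) = (-1) ^+ k * revp n p.
Proof.
have -> : (-1) ^+ k = ((-1) ^+ k : int)%:P by rewrite rmorphXn rmorphN1.
by rewrite !mul_polyC revpZ.
Qed.

Lemma invKL_assignment_exists : {Q : matroid T -> {poly int} | is_invKL Q}.
Proof.
pose g M := iklf #|ground M|.+1 M.
have gE M : g M = if rank M == 0%N then (ground M == set0)%:R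
    else lowp (rank M) (sumQ g M).
  rewrite {1}/g /=; case: ifP => // _.
  congr lowp; apply: eq_bigr => F /andP[fF nF]; congr (_ * _).
  by apply: iklf_fuel => //; apply: ground_restr_lt.
have ng : KL_normalized g.
  split=> M r0; rewrite gE; first by rewrite r0.
  by rewrite (gtn_eqF r0) /=; exact: size_lowp.
have sizeS k (p : {poly int}) : size ((-1) ^+ k * p) = size p.
  have -> : (-1) ^+ k = ((-1) ^+ k : int)%:P by rewrite rmorphXn rmorphN1.
  by rewrite mul_polyC size_scale // signr_eq0.
exists (fun M => (-1) ^+ rank M * g M); split.
  case: ng => ng0 ng1; split=> M r0; last by rewrite sizeS; apply: ng1.
  by rewrite r0 mul1r ng0.
suff main M : rev g M = conv g (rev chi) M.
  move=> M; apply: etrans (esym (invKL_conv (fun N => (-1) ^+ rank N * g N) M)).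
  rewrite revp_sign mulrA -expr2 sqrr_sign mul1r.
  rewrite -[LHS]/(rev g M) main; apply: eq_conv => // N.
  by rewrite mulrA -expr2 sqrr_sign mul1r.
have bg := normalized_bdd ng.
move: {2}#|ground M|.+1 (ltnSn #|ground M|) => n; elim: n M => // n IHn M ltM.
have [|sS aS] := sumQ_anti (M := M) bg.
  by move=> N ltN; apply: IHn; move: ltN ltM; lia.
rewrite conv_sumQ /rev.
have [r0|r0] := posnP (rank M); last first.
  by rewrite {1 2}gE (gtn_eqF r0) /=; apply: revp_lowp.
rewrite [sumQ _ _]big_pred0 => [|F]; last first.
  apply/negbTE; rewrite negb_and negbK; have [fF|//] := boolP (flat M F).
  rewrite orFb eqEsubset flat_sub //=; apply/subsetP => x xE.
  have [//|xF] := boolP (x \in F); have [_ /(_ x xE xF)] := flatP _ _ fF.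
  by have := rk_le_rank M (x |: F); rewrite r0; lia.
rewrite gE r0 eqxx addr0; case: eqP => _; last by rewrite revp0.
by rewrite -(expr0 'X) revpXn.
Qed.

Lemma KL_assignment_unique P P' : is_KL P -> is_KL P' -> P =1 P'.
Proof.
case=> nP hP [nP' hP'] M.
move: {2}#|ground M|.+1 (ltnSn #|ground M|) => n; elim: n M => // n IHn M ltM.
have [r0|r0] := posnP (rank M); first by rewrite nP.1 // nP'.1.
have := hP M; have := hP' M.
rewrite -[X in _ = X -> _]/(conv chi P' M) -[X in _ -> _ = X -> _]/(conv chi P M).
have [f0|nf0] := boolP (flat M set0); last first.
  have z f : conv chi f M = 0.
    by rewrite /conv big1 // => F fF; rewrite [chi _]charpoly_loop ?flat0_restr // mul0r.
  rewrite !z => e' e.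
  rewrite -[LHS](revpK (normalized_bdd nP M)) -[RHS](revpK (normalized_bdd nP' M)).
  by rewrite e e'.
rewrite !conv_sumP // => e' e.
have eS : sumP P M = sumP P' M.
  apply: eq_bigr => F /andP[fF nF]; congr (_ * _); apply: IHn.
  by have := ground_contr_lt fF nF; move: ltM; lia.
apply: (low_uniq r0 (nP.2 M r0) (nP'.2 M r0)).
by rewrite e e' eS [P M + _]addrC [P' M + _]addrC !addrK.
Qed.

Lemma invKL_assignment_unique Q Q' : is_invKL Q -> is_invKL Q' -> Q =1 Q'.
Proof.
case=> nQ hQ [nQ' hQ'] M.
move: {2}#|ground M|.+1 (ltnSn #|ground M|) => n; elim: n M => // n IHn M ltM.
have [r0|r0] := posnP (rank M); first by rewrite nQ.1 // nQ'.1.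
have := hQ M; have := hQ' M; rewrite !invKL_conv !conv_sumQ => e' e.
set S := sumQ _ M in e; set S' := sumQ _ M in e'.
have eS : S = S'.
  apply: eq_bigr => F /andP[fF nF]; congr (_ * _); congr (_ * _); apply: IHn.
  by have := ground_restr_lt fF nF; move: ltM; lia.
apply: (low_uniq r0 (nQ.2 M r0) (nQ'.2 M r0)).
apply: (can_inj (g := fun p => (-1) ^+ rank M * p)
          (f := fun p : {poly int} => (-1) ^+ rank M * p)).
  by move=> p; rewrite mulrA -expr2 sqrr_sign mul1r.
by rewrite !mulrBr e e' eS addrC addKr [RHS]addrC addKr.
Qed.
End Exist.

End MatroidFacts.

Section KLpolynomials.
Variable T : finType.
Implicit Type M : matroid T.

Definition KL : matroid T -> {poly int} :=
  sval (MatroidFacts.KL_assignment_exists T).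

Definition invKL : matroid T -> {poly int} :=
  sval (MatroidFacts.invKL_assignment_exists T).

Definition Zpoly M : {poly int} :=
  \sum_(F | flat M F) 'X^(rk M F) * KL (contr M F).

Lemma KL_spec : is_KL KL.
Proof. exact: svalP. Qed.

Lemma KL_unique P : is_KL P -> P =1 KL.
Proof. by move=> hP; apply: MatroidFacts.KL_assignment_unique KL_spec. Qed.

Lemma invKL_spec : is_invKL invKL.
Proof. exact: svalP. Qed.

Lemma invKL_unique Q : is_invKL Q -> Q =1 invKL.
Proof. by move=> hQ; apply: MatroidFacts.invKL_assignment_unique invKL_spec. Qed.

End KLpolynomials.

(* Main.v *)
(** If F is not a flat then the contraction by F has a loop, so both its
    Kazhdan-Lusztig and its characteristic polynomial vanish; hence the defining
    recursions may be summed over all subsets F of the ground set.  Comparing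
    them term by term for M and its relaxation M', only the terms with F contained
    in H or F equal to the ground set change.  If F is a proper subset of H, then
    M^F is uniform, M'^F = M^F, and M'_F is the relaxation of M_F by H \ F, of
    rank k - |F|.  So the difference D of the polynomials satisfies
    t^k D(1/t) - D = S with S depending only on k (by induction on k for P), and
    since deg D < k/2 this determines D. *)

Require Import Defs.
From mathcomp Require Import all_boot all_order all_algebra.
From mathcomp Require Import zify ring.
Import GRing.Theory.
Local Open Scope ring_scope.

Section Relaxation.
Set Implicit Arguments.
Unset Strict Implicit.
Unset Printing Implicit Defensive.
Import MatroidFacts.

(** * Bounded choice, sums over subsets and reversed polynomials *)

(* Bounded choice for course-of-values recursion, avoiding a choice axiom. *)
Lemma exists_upto (A : Type) (a0 : A) (R : nat -> A -> Prop) :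
    (forall n u, (forall i, (i < n)%N -> R i (u i)) -> exists v, R n v) ->
  forall n, exists u, forall i, (i < n)%N -> R i (u i).
Proof.
move=> step; elim=> [|n [u hu]]; first by exists (fun=> a0).
have [v hv] := step n u hu.
exists (fun i => if i == n then v else u i) => i; rewrite ltnS leq_eqVlt.
by case: eqVneq => [-> _|_ /= lt_in] //; apply: hu.
Qed.

(** Grouping subsets by cardinality removes the matroid from the recursions: what remains depends on
    the size of [B] alone. *)
Lemma sum_powerset_card (V : nmodType) (T : finType) (B : {set T}) (f : nat -> V) :
  \sum_(A in powerset B) f #|A| = \sum_(i < #|B|.+1) f i *+ 'C(#|B|, i).
Proof.
have cardB (A : {set T}) : A \in powerset B -> (#|A| < #|B|.+1)%N.
  by rewrite powersetE ltnS => /subset_leq_card.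
rewrite (partition_big (fun A : {set T} => inord #|A| : 'I_#|B|.+1) predT) //=.
apply: eq_bigr => i _; rewrite -cards_draws -sumr_const; apply: congr_big => // [A|A].
  rewrite powersetE inE; have [sAB|//] := boolP (A \subset B).
  by rewrite /= -val_eqE /= inordK // cardB // powersetE.
by case/andP=> AB /eqP <-; rewrite inordK ?cardB.
Qed.

(** As [p] has degree below [k/2], for each [i] below [k/2] coefficient [k - i] of [S] equals
    coefficient [i] of [p]. *)
Lemma lowp_unique k (p S : {poly int}) :
  (0 < k)%N -> ((size p).-1.*2 < k)%N -> revp k p - p = S -> p = lowp k S.
Proof.
move=> k0 sp eS; apply/polyP => i; rewrite coef_poly -eS coefB coef_revp leq_subr.
case: ifP => hi; last by rewrite coef_ge //; lia.
have -> : (k - (k - i) = i)%N by lia.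
by rewrite [p`_(k - i)]coef_ge ?subr0 //; lia.
Qed.

Lemma size_sub_half k (p q : {poly int}) :
  ((size p).-1.*2 < k)%N -> ((size q).-1.*2 < k)%N -> ((size (p - q)%R).-1.*2 < k)%N.
Proof.
move=> sp sq; have := size_polyD p (- q); rewrite size_polyN leq_max.
by case/orP=> h; [apply: leq_ltn_trans sp | apply: leq_ltn_trans sq];
  rewrite leq_double -!subn1 leq_sub2r.
Qed.

Lemma revpB n (p q : {poly int}) : revp n (p - q) = revp n p - revp n q.
Proof. by apply/polyP => i; rewrite coefB !coef_revp coefB; case: ifP; rewrite ?subr0. Qed.

(** * Recursions summed over all subsets; matroids of rank one *)

Section Sums.
Variable T : finType.
Implicit Types (M : matroid T) (A F H : {set T}).

Lemma flat_contr0 M F : F \subset ground M -> flat (contr M F) set0 = flat M F.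
Proof. by move=> sF; rewrite flat_contr // sub0set set0U -setI_eq0 set0I eqxx. Qed.

(** A loop lies in every flat, so every characteristic polynomial in the recursion vanishes;
    reversal is injective on polynomials of degree at most the rank. *)
Lemma KL_loop M : ~~ flat M set0 -> KL M = 0.
Proof.
move=> nf; rewrite -[LHS](revpK (normalized_bdd (KL_spec T).1 M)) (KL_spec T).2.
rewrite big1 ?revp0 // => F fF.
by rewrite charpoly_loop ?mul0r // flat0_restr.
Qed.

Lemma KL_contr_nonflat M F : F \subset ground M -> ~~ flat M F -> KL (contr M F) = 0.
Proof. by move=> sF nF; rewrite KL_loop // flat_contr0. Qed.

Lemma charpoly_contr_nonflat M F :
  F \subset ground M -> ~~ flat M F -> charpoly (contr M F) = 0.
Proof. by move=> sF nF; rewrite charpoly_loop // flat_contr0. Qed.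

(** Lets a matroid and its relaxation be summed over one index set although their flats differ. *)
Lemma sum_flat M (f : {set T} -> {poly int}) :
    (forall F, F \subset ground M -> ~~ flat M F -> f F = 0) ->
  \sum_(F | flat M F) f F = \sum_(F in powerset (ground M)) f F.
Proof.
move=> f0; rewrite [RHS](bigID (flat M)) /= [X in _ + X]big1 ?addr0 => [|F /andP[]].
  apply: eq_bigl => F; rewrite powersetE.
  by have [/flat_sub->|] := boolP (flat M F); rewrite ?andbF.
by rewrite powersetE; apply: f0.
Qed.

Lemma KL_sum M : revp (rank M) (KL M) =
  \sum_(F in powerset (ground M)) charpoly (restr M F) * KL (contr M F).
Proof.
by rewrite (KL_spec T).2 sum_flat // => F sF nF; rewrite KL_contr_nonflat ?mulr0.
Qed.

Lemma invKL_sum M : (-1) ^+ rank M * revp (rank M) (invKL M) =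
  \sum_(F in powerset (ground M)) (-1) ^+ rk M F * invKL (restr M F) *
    revp (rank M - rk M F) (charpoly (contr M F)).
Proof.
rewrite (invKL_spec T).2 sum_flat // => F sF nF.
by rewrite charpoly_contr_nonflat // revp0 mulr0.
Qed.

Lemma Zpoly_sum M :
  Zpoly M = \sum_(F in powerset (ground M)) 'X^(rk M F) * KL (contr M F).
Proof.
by rewrite /Zpoly sum_flat // => F sF nF; rewrite KL_contr_nonflat ?mulr0.
Qed.

Lemma ground_contr_ground M : ground (contr M (ground M)) = set0.
Proof. exact: setDv. Qed.

Lemma KL_ground0 M : ground M = set0 -> KL M = 1.
Proof. by move=> e; rewrite (KL_spec T).1.1 ?rank_ground0 // e eqxx. Qed.

Lemma nonflat_spanning M F :
  F \subset ground M -> F != ground M -> rk M F = rank M -> ~~ flat M F.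
Proof.
move=> sF nF rF; apply: contra nF => /flatP[_ h]; rewrite eqEsubset sF /=.
apply/subsetP => x xE; have [//|xF] := boolP (x \in F).
by have := h x xE xF; have := rk_le_rank M (x |: F); lia.
Qed.

Lemma ground_rank1 M : rank M = 1%N -> ground M != set0.
Proof. by move=> r1; apply: contra_eq_neq r1 => /rank_ground0->. Qed.

Lemma loopless_rk_gt0 M A :
  flat M set0 -> A \subset ground M -> A != set0 -> (0 < rk M A)%N.
Proof.
case/flatP=> _ h sA /set0Pn[x xA].
have := h x (subsetP sA x xA); rewrite in_set0 rk0 setU0 => /(_ isT) r1.
by apply: leq_trans r1 (rkS M _); rewrite sub1set.
Qed.

(** Every nonempty set has rank one, so subtracting the alternating sum of [1] over all subsets,
    which is zero, leaves only the term of the empty set. *)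
Lemma charpoly_rank1 M : rank M = 1%N -> flat M set0 -> charpoly M = 'X - 1.
Proof.
move=> r1 f0; have /set0Pn[e eE] := ground_rank1 r1.
have alt : \sum_(A in powerset (ground M)) (-1) ^+ #|A| * (1 : {poly int}) = 0.
  exact: alt_sum0 eE _.
have P0 : set0 \in powerset (ground M) by rewrite powersetE sub0set.
rewrite -[LHS]subr0 -alt /charpoly -sumrB (bigD1 set0) //= cards0 rk0 r1 big1.
  by rewrite !mul1r addr0.
move=> A /andP[]; rewrite powersetE => sA nA; rewrite -mulrBr.
have -> : (1 - rk M A = 0)%N by have := loopless_rk_gt0 f0 sA nA; lia.
by rewrite expr0 subrr mulr0.
Qed.

(** Proper nonempty subsets span and are not flats, so [p = KL M] satisfies
    [revp 1 p = p + ('X - 1)], and so does [1]. *)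
Lemma KL_rank1 M : rank M = 1%N -> flat M set0 -> KL M = 1.
Proof.
move=> r1 f0; have nE := ground_rank1 r1.
apply: (@low_uniq 1) => //; [|by rewrite size_poly1|].
  by rewrite -[X in (_ < X)%N]r1 (KL_spec T).1.2 // r1.
rewrite -{1}r1 KL_sum (bigD1 set0) /= ?powersetE ?sub0set //.
rewrite (bigD1 (ground M)) /= ?powersetE ?subxx //.
rewrite big1 => [|F /andP[/andP[]]]; last first.
  rewrite powersetE => sF nF nFE; rewrite KL_contr_nonflat ?mulr0 //.
  apply: nonflat_spanning => //.
  by have := loopless_rk_gt0 f0 sF nF; have := rk_le_rank M F; lia.
have -> : revp 1 1 = 'X by rewrite -(expr0 'X) revpXn.
rewrite contr0 restr_ground (charpoly_rank1 r1 f0).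
rewrite (KL_ground0 (ground_contr_ground M)).
by rewrite charpoly_ground0 /= ?setI0 // mul1r mulr1 addr0 [LHS]addrC addKr.
Qed.
End Sums.

(** * Uniform matroids *)

Section Uniform.
Variable T : finType.
Implicit Types (M : matroid T) (A F H : {set T}).

(* The exact rank is [minn #|ground M| d], so that [uniform d] is inherited by
   every restriction. *)
Definition uniform d M := forall A, A \subset ground M -> rk M A = minn #|A| d.

Definition uniform_charpoly d n : {poly int} :=
  \sum_(i < n.+1) ((-1) ^+ i * 'X^(minn n d - minn i d)) *+ 'C(n, i).

Lemma uniform_rank d M : uniform d M -> rank M = minn #|ground M| d.
Proof. by move=> uM; apply: uM. Qed.

Lemma charpoly_uniform d M : uniform d M ->
  charpoly M = uniform_charpoly d #|ground M|.
Proof.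
move=> uM; rewrite /charpoly /uniform_charpoly (uniform_rank uM).
rewrite -(sum_powerset_card _ (fun i => (-1) ^+ i * 'X^(minn _ d - minn i d))).
by apply: eq_bigr => A; rewrite powersetE => sA; rewrite uM.
Qed.

Lemma uniform_restr d M F : uniform d M -> F \subset ground M -> uniform d (restr M F).
Proof.
move=> uM sF A /=; rewrite subsetI => /andP[sA sAF].
by rewrite rk_restr (setIidPl sAF) uM.
Qed.

(** The truncated subtraction is the right one: contracting [d] or more elements leaves rank
    zero. *)
Lemma uniform_contr d M F :
  uniform d M -> F \subset ground M -> uniform (d - #|F|) (contr M F).
Proof.
move=> uM sF A /=; rewrite subsetD => /andP[sA dA].
rewrite rk_contr !uM ?subUset ?sA // cardsU (disjoint_setI0 dA) cards0; lia.
Qed.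
End Uniform.

(** Strong induction on the number of elements: minors of uniform matroids are uniform, so every
    term but that of the ground set depends only on [#|F|]. This is needed for the restrictions to
    subsets of [H] in the recursion for [invKL]. *)
Lemma invKL_uniform d n : exists u : {poly int},
  forall (T : finType) (M : matroid T),
    uniform d M -> #|ground M| = n -> invKL M = u.
Proof.
pose R m (u : {poly int}) := forall (T : finType) (M : matroid T),
    uniform d M -> #|ground M| = m -> invKL M = u.
suff step m u : (forall i, (i < m)%N -> R i (u i)) -> exists v, R m v.
  by have [u /(_ n (ltnSn n))] := exists_upto 0 step n.+1; exists (u n).
move=> hu; pose r := minn m d.
have [r0|r0] := posnP r.
  exists (m == 0%N)%:R => T M uM cM.
  by rewrite (invKL_spec T).1.1 -?cards_eq0 ?cM // (uniform_rank uM) cM.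
pose h i := (-1) ^+ minn i d * u i * revp (r - minn i d) (uniform_charpoly (d - i) (m - i)).
pose S := \sum_(i < m) h i *+ 'C(m, i).
exists (lowp r ((-1) ^+ r * S)) => T M uM cM.
have rM : rank M = r by rewrite (uniform_rank uM) cM.
apply: lowp_unique => //; first by rewrite -rM (invKL_spec T).1.2 // rM.
have := invKL_sum M; rewrite rM.
(* The term of the ground set is the unknown itself; including it makes the whole sum a function of
   cardinality. *)
pose g i := if i == m then (-1) ^+ r * invKL M else h i.
rewrite (eq_bigr (fun F : {set T} => g #|F|)); last first.
  move=> F; rewrite powersetE => sF; rewrite /g -cM uM //.
  have [eF|nF] := eqVneq #|F| #|ground M|.
    have -> : F = ground M by apply/eqP; rewrite eqEcard sF eF leqnn.
    rewrite restr_ground cM -/r subnn charpoly_ground0 ?ground_contr_ground //.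
    by rewrite -[X in revp 0 X](expr0 'X) revpXn // subnn expr0 mulr1.
  have lF : (#|F| < m)%N by rewrite -cM ltn_neqAle nF subset_leq_card.
  congr (_ * _ * revp _ _).
    by apply: (hu _ lF); [exact: uniform_restr | rewrite /= (setIidPr sF)].
  rewrite (charpoly_uniform (uniform_contr uM sF)) /=.
  by rewrite cardsD (setIidPr sF) cM.
rewrite sum_powerset_card cM big_ord_recr /= /g eqxx binn mulr1n.
rewrite (eq_bigr (fun i : 'I_m => h i *+ 'C(m, i))) => [e|i _]; last first.
  by rewrite ltn_eqF.
apply: (can_inj (signrMK r)); rewrite signrMK mulrBr e /S; ring.
Qed.

(** * Relaxations: rank functions and minors *)

Section Relaxed.
Variable T : finType.
Implicit Types (M : matroid T) (A B F H : {set T}).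

(** A maximal independent set between [A] and [B] spans [B]: an element of [B] raising its rank
    could be added to it. *)
Lemma indep_extend M A B : A \subset B -> B \subset ground M -> rk M A = #|A| ->
  exists C : {set T}, [/\ A \subset C, C \subset B, rk M C = #|C| & rk M C = rk M B].
Proof.
move=> sAB sB rA.
pose I := [pred C : {set T} | (C \subset B) && (rk M C == #|C|)].
have IA : I A by rewrite /= sAB rA eqxx.
have [C /maxsetP[/andP[sCB /eqP rC] hmax] sAC] := maxset_exists IA.
exists C; split => //; rewrite -(setUidPr sCB); apply/esym/rkU_const => x xB.
have [xC|xC] := boolP (x \in C); first by rewrite (setUidPr _) // sub1set.
apply/eqP; rewrite eqn_leq (rkS M (subsetUr [set x] C)) andbT leqNgt; apply/negP => lt.
have cx : #|x |: C| = #|C|.+1 by rewrite cardsU1 xC.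
have rx : rk M (x |: C) == #|x |: C|.
  by have := rk_card M (x |: C); rewrite cx; lia.
have := hmax (x |: C); rewrite /I /= subUset sub1set xB sCB rx subsetUr.
by move=> /(_ isT isT) e; rewrite -e setU11 in xC.
Qed.

(** A maximal independent subset of [A] in [M] extends to a basis of [M], hence of [N], and so stays
    independent in [N]. *)
Lemma rk_le_bases M N A :
  ground M = ground N -> bases M \subset bases N -> (rk M A <= rk N A)%N.
Proof.
move=> eE sMN; rewrite -rkI -[rk N A]rkI eE; set A' := A :&: ground N.
have sA : A' \subset ground M by rewrite eE subsetIr.
have := @indep_extend M set0 A'; rewrite sub0set rk0 cards0.
case=> // I [_ sI rI rIA].
have [B [sIB sB rB rBE]] := indep_extend (subset_trans sI sA) (subxx _) rI.
have : B \in bases M by rewrite basesE /indep sB rB eqxx /= -rB rBE /rank eqxx.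
move/(subsetP sMN); rewrite basesE => /andP[/andP[_ /eqP rNB] _].
have rNI : rk N I = #|I|.
  have := rk_submod N I (B :\: I); have := rk_card N I; have := rk_card N (B :\: I).
  have := setID B I; rewrite (setIidPr sIB) => ->; rewrite cardsD (setIidPr sIB) rNB.
  by have := subset_leq_card sIB; lia.
by rewrite -rIA rI -rNI rkS.
Qed.

Lemma bases_inj M N : ground M = ground N -> bases M = bases N -> M = N.
Proof.
move=> eE eB; apply: matroid_ext => // A.
by apply/eqP; rewrite eqn_leq !rk_le_bases // eB.
Qed.

(* Unlike [is_relaxation], this is visibly stable under contraction by a proper
   subset of [H]. *)
Record relaxed M H M' : Prop := Relaxed {
  relaxed_ground : ground M' = ground M;
  relaxed_rk : forall A, rk M' A = (rk M A + (A :&: ground M == H))%N;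
  relaxed_rank : rank M = #|H|;
  relaxed_rkH : (rk M H).+1 = #|H|;
  relaxed_flat : flat M H;
  relaxed_proper : forall A, A \proper H -> rk M A = #|A| }.

(** Bases determine a matroid, so [M'] is the one built from [relax_axioms], whose rank function is
    explicit. *)
Lemma relaxation_relaxed M H M' :
  circuit_hyperplane M H -> is_relaxation M H M' -> relaxed M H M'.
Proof.
move=> cH [eE eB]; have [cardH rH fH hp] := circuit_hyperplane_card cH.
have sH := flat_sub fH.
pose N := Matroid (relax_axioms cH).
have rN A : rk N A = (rk M A + (A :&: ground M == H))%N by rewrite /rk ffunE.
have nEH : ground M != H by apply: contraTneq isT => e; move: rH; rewrite /rank e; lia.
have rankN : rank N = rank M by rewrite /rank rN setIid (negbTE nEH) addn0.
have -> : M' = N.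
  apply: bases_inj => //; rewrite eB; apply/setP => B.
  rewrite in_setU1 !basesE rankN /indep rN /=.
  have [->|nB] := eqVneq B H.
    by rewrite (setIidPl sH) sH eqxx addn1 rH cardH eqxx.
  have [sB|//] := boolP (B \subset ground M).
  by rewrite (setIidPl sB) (negbTE nB) addn0.
by split; rewrite ?cardH.
Qed.

Section RelaxedTheory.
Variables (M : matroid T) (H : {set T}) (M' : matroid T).
Hypothesis rel : relaxed M H M'.

Lemma relaxed_sub : H \subset ground M.
Proof. exact: flat_sub (relaxed_flat rel). Qed.

Lemma relaxed_neq_ground : H != ground M.
Proof.
by apply/eqP => e; have := relaxed_rkH rel; rewrite -(relaxed_rank rel) e /rank; lia.
Qed.

Lemma relaxed_rk_neq F : F \subset ground M -> F != H -> rk M' F = rk M F.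
Proof.
by move=> sF nF; rewrite (relaxed_rk rel) (setIidPl sF) (negbTE nF) addn0.
Qed.

Lemma relaxed_rank_eq : rank M' = rank M.
Proof.
by rewrite /rank (relaxed_ground rel) relaxed_rk_neq // eq_sym relaxed_neq_ground.
Qed.

(** [H] is a basis of [M'], so it spans without being the ground set. *)
Lemma relaxed_nonflat : ~~ flat M' H.
Proof.
apply: nonflat_spanning; rewrite ?(relaxed_ground rel) ?relaxed_sub ?relaxed_neq_ground //.
rewrite relaxed_rank_eq (relaxed_rank rel) (relaxed_rk rel).
by rewrite (setIidPl relaxed_sub) eqxx addn1 (relaxed_rkH rel).
Qed.

(** A proper subset of the circuit [H] is independent, with the same rank in both matroids, so the
    extra unit of rank at [H] passes to [H :\: F]. *)
Lemma relaxed_contr F : F \proper H -> relaxed (contr M F) (H :\: F) (contr M' F).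
Proof.
move=> pF; have sF := proper_sub pF; have rF := relaxed_proper rel pF.
have sH := relaxed_sub; have sFE := subset_trans sF sH.
have cF := proper_card pF.
have cHF : #|H :\: F| = (#|H| - #|F|)%N by rewrite cardsD (setIidPr sF).
have UF : H :\: F :|: F = H.
  apply/setP => x; rewrite !inE; have := subsetP sF x.
  by case: (x \in F) => [->//|_]; rewrite ?orbF.
split => /=.
- by rewrite (relaxed_ground rel).
- move=> A; rewrite !rk_contr (relaxed_rk_neq sFE (proper_neq pF)) (relaxed_rk rel).
  (* [F] lies in [H], and [H] in the ground set, so the elements of [F] affect neither equality. *)
  have -> : ((A :|: F) :&: ground M == H) = (A :&: (ground M :\: F) == H :\: F).
    apply/eqP/eqP => [e|e]; apply/setP => x.
      rewrite -e !inE; case xF: (x \in F) => /=; first by rewrite andbF.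
      by rewrite orbF.
    move/setP/(_ x): e; rewrite !inE.
    have := subsetP sF x; have := subsetP sFE x.
    case: (x \in F) => /= [/(_ isT)-> /(_ isT)-> _|_ _]; first by rewrite orbT.
    by rewrite orbF.
  by have := rkS M (subsetUr A F); lia.
- by rewrite rank_contr (relaxed_rank rel) rF cHF.
- by rewrite rk_contr UF rF cHF; have := relaxed_rkH rel; lia.
- rewrite flat_contr // UF (relaxed_flat rel) andbT subDset subsetU ?sH ?orbT //=.
  by rewrite -setI_eq0 setIDAC setDIl setDv setI0.
- move=> A pA; have dA : A :&: F = set0.
    apply/eqP; rewrite setI_eq0; have := proper_sub pA.
    by rewrite subsetD => /andP[].
  have pU : A :|: F \proper H.
    rewrite properEcard subUset sF.
    have := proper_sub pA; rewrite subsetD => /andP[-> _] /=.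
    by have := proper_card pA; rewrite cardsU dA cards0 cHF; lia.
  by rewrite rk_contr (relaxed_proper rel pU) rF cardsU dA cards0; lia.
Qed.

(** The rank functions differ only on sets meeting the ground set in [H]; no set containing [F] does
    so. *)
Lemma relaxed_contr_eq F :
  F \subset ground M -> ~~ (F \subset H) -> contr M' F = contr M F.
Proof.
move=> sF nF; apply: matroid_ext => [|A] /=; first by rewrite (relaxed_ground rel).
rewrite !rk_contr (relaxed_rk_neq sF); last by apply: contraNneq nF => ->.
rewrite (relaxed_rk rel) [_ == H]negbTE ?addn0 //.
by apply: contraNneq nF => <-; rewrite subsetI subsetUr.
Qed.

Lemma relaxed_restr_eq F :
  F \subset ground M -> ~~ (H \subset F) -> restr M' F = restr M F.
Proof.
move=> sF nF; apply: matroid_ext => [|A] /=; first by rewrite (relaxed_ground rel).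
rewrite !rk_restr (relaxed_rk rel) [_ == H]negbTE ?addn0 //.
by apply: contraNneq nF => <-; rewrite -setIA setIC -setIA subsetIl.
Qed.

(** Because [H] is a hyperplane. Sets strictly between [H] and the ground set are thus not flats and
    drop out of the recursions. *)
Lemma relaxed_spanning F :
  F \subset ground M -> H \proper F -> rk M F = rank M.
Proof.
move=> sF /properP[sHF [x xF xH]]; have [_ h] := flatP _ _ (relaxed_flat rel).
have := h x (subsetP sF x xF) xH.
have : (rk M (x |: H) <= rk M F)%N by rewrite rkS // subUset sub1set xF.
have := rk_le_rank M F; have := relaxed_rkH rel; rewrite (relaxed_rank rel); lia.
Qed.

(** Proper subsets of the circuit [H] are independent, and [H] itself has rank [#|H|.-1], so [F = H]
    is covered too. *)
Lemma relaxed_uniform F : F \subset H -> uniform #|H|.-1 (restr M F).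
Proof.
move=> sF A /=; rewrite subsetI => /andP[_ sAF]; rewrite rk_restr (setIidPl sAF).
have sAH := subset_trans sAF sF; have rH := relaxed_rkH rel.
have [->|nA] := eqVneq A H; first by lia.
have pA : A \proper H by rewrite properEneq nA.
by rewrite (relaxed_proper rel pA); have := proper_card pA; lia.
Qed.

(** Only the summand of [A = H] changes: its exponent drops from 1 to 0. *)
Lemma relaxed_charpoly :
  charpoly M' = charpoly M + (-1) ^+ #|H| * (1 - 'X).
Proof.
have PH : H \in powerset (ground M) by rewrite powersetE relaxed_sub.
rewrite /charpoly (relaxed_ground rel) relaxed_rank_eq.
rewrite (bigD1 H) //= [in RHS](bigD1 H) //=.
rewrite (relaxed_rk rel) (setIidPl relaxed_sub) eqxx addn1.
rewrite (relaxed_rank rel) (relaxed_rkH rel) subnn.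
have -> : (#|H| - rk M H = 1)%N by have := relaxed_rkH rel; lia.
rewrite [in RHS]addrAC -mulrDr expr0 expr1 addrC [RHS]addrC addrCA subrr addr0; congr (_ + _).
apply: eq_bigr => A /andP[]; rewrite powersetE => sA nA.
by rewrite relaxed_rk_neq.
Qed.

Lemma relaxed_sum_sub (f f' : {set T} -> {poly int}) :
    (forall F, F \subset ground M -> ~~ (F \subset H) -> F != ground M -> f' F = f F) ->
  \sum_(F in powerset (ground M)) f' F - \sum_(F in powerset (ground M)) f F =
  \sum_(F in powerset H) (f' F - f F) + (f' (ground M) - f (ground M)).
Proof.
move=> ff'; rewrite -sumrB (bigID (fun F => F \subset H)) /=; congr (_ + _).
  apply: eq_bigl => F; rewrite !powersetE.
  by have [sF|] := boolP (F \subset H); rewrite ?andbF // (subset_trans sF relaxed_sub).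
rewrite (bigD1 (ground M)) /=.
  rewrite big1 ?addr0 // => F /andP[/andP[]]; rewrite powersetE => sF nF nE.
  by rewrite ff' // subrr.
rewrite powersetE subxx /=; apply: contraNN relaxed_neq_ground => s.
by rewrite eqEsubset s relaxed_sub.
Qed.

Lemma relaxed_contr_rank1 : rank (contr M H) = 1%N.
Proof. by rewrite rank_contr (relaxed_rank rel); have := relaxed_rkH rel; lia. Qed.

Lemma relaxed_contr_loopless : flat (contr M H) set0.
Proof. exact: flat0_contr (relaxed_flat rel). Qed.

Lemma relaxed_KL_contrH : KL (contr M H) = 1.
Proof. exact: KL_rank1 relaxed_contr_rank1 relaxed_contr_loopless. Qed.

Lemma relaxed_KL_contrH' : KL (contr M' H) = 0.
Proof.
by rewrite KL_contr_nonflat ?relaxed_nonflat // (relaxed_ground rel) relaxed_sub.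
Qed.
End RelaxedTheory.
End Relaxed.

(** * Shifts of the three polynomials under relaxation *)

Definition KL_shift n (p : {poly int}) :=
  forall (T : finType) (M M' : matroid T) (H : {set T}),
    relaxed M H M' -> rank M = n -> KL M' = KL M + p.

Lemma KL_shift_step n u :
  (forall i, (i < n)%N -> KL_shift i (u i)) -> exists p, KL_shift n p.
Proof.
(* Contribution of one subset of [H] of size [i >= 1]: for [i < n] the contraction has smaller rank
   and induction applies; for [F = H] only [M] contributes, with [KL (contr M H) = 1]. *)
move=> hu; pose h i := if (i < n)%N then uniform_charpoly n.-1 i * u (n - i)%N
                       else - uniform_charpoly n.-1 i.
(* The empty set is left out, its term being the unknown difference; the last summand is the change
   of the characteristic polynomial, coming from the ground set. *)
pose S := \sum_(i < n) h i.+1 *+ 'C(n, i.+1) + (-1) ^+ n * (1 - 'X).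
exists (lowp n S) => T M M' H rel rM.
have cH : #|H| = n by rewrite -(relaxed_rank rel).
have n0 : (0 < n)%N by rewrite -cH -(relaxed_rkH rel).
have rM' : rank M' = n by rewrite (relaxed_rank_eq rel).
suff <- : KL M' - KL M = lowp n S by rewrite [RHS]addrC subrK.
apply: lowp_unique => //.
  by apply: size_sub_half; rewrite -?rM' ?(KL_spec T).1.2 ?rM' // -rM (KL_spec T).1.2 ?rM.
rewrite revpB -{1}rM' -rM !KL_sum (relaxed_ground rel) (relaxed_sum_sub rel); last first.
  (* The restrictions can differ only if [H] lies in [F]; then [F] spans and is not a flat, so both
     terms vanish. *)
  move=> F sF nFH nFE; rewrite (relaxed_contr_eq rel sF nFH).
  have [sHF|nHF] := boolP (H \subset F); last by rewrite (relaxed_restr_eq rel sF nHF).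
  rewrite KL_contr_nonflat ?mulr0 //; apply: nonflat_spanning => //.
  by apply: (relaxed_spanning rel) => //; rewrite properE sHF.
have eg := relaxed_ground rel; rewrite -{1 2}eg !restr_ground eg.
rewrite (relaxed_contr_eq rel) ?subxx //; last first.
  apply: contraNN (relaxed_neq_ground rel) => s.
  by rewrite eqEsubset s (relaxed_sub rel).
rewrite (KL_ground0 (ground_contr_ground M)) !mulr1 (relaxed_charpoly rel) cH.
pose g i := if i == 0%N then KL M' - KL M else h i.
rewrite (eq_bigr (fun F : {set T} => g #|F|)); last first.
  move=> F; rewrite powersetE => sF; rewrite /g cards_eq0.
  have sFE := subset_trans sF (relaxed_sub rel).
  have chiF : charpoly (restr M F) = uniform_charpoly n.-1 #|F|.
    rewrite (charpoly_uniform (relaxed_uniform rel sF)) cH /=.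
    by rewrite (setIidPr sFE).
  have [F0|nF0] := eqVneq F set0.
    rewrite F0 !contr0 !charpoly_ground0 ?mul1r //= setI0 //.
  have [eF|nF] := eqVneq F H.
    rewrite {}eF in chiF *.
    rewrite (relaxed_KL_contrH rel) (relaxed_KL_contrH' rel) mulr0 mulr1 sub0r.
    by rewrite /h cH ltnn chiF cH.
  have pF : F \proper H by rewrite properEneq nF.
  have cF := proper_card pF; rewrite cH in cF.
  rewrite (relaxed_restr_eq rel) //; last by apply: contraNN nF => s; rewrite eqEsubset sF.
  have nF0' : (0 < #|F|)%N by rewrite card_gt0.
  rewrite -mulrBr chiF /h cF; congr (_ * _).
  rewrite (hu (n - #|F|)%N _ _ _ _ _ (relaxed_contr rel pF)).
  - by rewrite addrC addKr.
  - lia.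
  - by rewrite rank_contr rM (relaxed_proper rel pF).
rewrite sum_powerset_card cH big_ord_recl /= /g /= bin0 mulr1n /S.
by rewrite [charpoly M + _]addrC addrK -(addrA (KL M' - KL M)) [LHS]addrC addKr.
Qed.

Lemma KL_shift_exists k : exists p, forall i, (i <= k)%N -> KL_shift i (p i).
Proof. exact: (@exists_upto _ 0 KL_shift KL_shift_step k.+1). Qed.

(** No further recursion is needed: [Zpoly] is a sum over contractions, so the shifts of [KL] in
    ranks up to [k] suffice, rank [k] itself coming from the empty set. *)
Lemma Zpoly_shift_exists k : exists z : {poly int},
  forall (T : finType) (M M' : matroid T) (H : {set T}),
    relaxed M H M' -> rank M = k -> Zpoly M' = Zpoly M + z.
Proof.
have [p hp] := KL_shift_exists k.
(* At [i = k] the set is [H], of rank [k.-1] in [M]; it is no longer a flat of [M'], so its term is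
   lost. *)
pose h i := if (i < k)%N then 'X^i * p (k - i)%N else - 'X^(k.-1).
exists (\sum_(i < k.+1) h i *+ 'C(k, i)) => T M M' H rel rM.
have cH : #|H| = k by rewrite -(relaxed_rank rel).
have nH := relaxed_neq_ground rel.
have nsub : ~~ (ground M \subset H).
  by apply: contraNN nH => s; rewrite eqEsubset s (relaxed_sub rel).
have out (F : {set T}) : F \subset ground M -> ~~ (F \subset H) ->
    'X^(rk M' F) * KL (contr M' F) = 'X^(rk M F) * KL (contr M F) :> {poly int}.
  move=> sF nF; rewrite (relaxed_contr_eq rel) // (relaxed_rk_neq rel) //.
  by apply: contraNneq nF => ->.
set z := \sum_(i < _) _.
suff <- : Zpoly M' - Zpoly M = z by rewrite [RHS]addrC subrK.
rewrite !Zpoly_sum (relaxed_ground rel) (relaxed_sum_sub rel) => [|F sF nF _]; last exact: out.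
rewrite out // subrr addr0 /z -cH -sum_powerset_card.
apply: eq_bigr => F; rewrite powersetE => sF; rewrite /h.
have sFE := subset_trans sF (relaxed_sub rel).
have [->|nF] := eqVneq F H.
  rewrite (relaxed_KL_contrH rel) (relaxed_KL_contrH' rel) mulr0 mulr1 sub0r.
  by rewrite cH ltnn -cH -(relaxed_rkH rel).
have pF : F \proper H by rewrite properEneq nF.
have cF := proper_card pF; rewrite cH in cF.
rewrite (relaxed_rk_neq rel) // cF (relaxed_proper rel pF) -mulrBr; congr (_ * _).
rewrite (hp (k - #|F|)%N _ _ _ _ _ (relaxed_contr rel pF)).
- by rewrite addrC addKr.
- exact: leq_subr.
- by rewrite rank_contr rM (relaxed_proper rel pF).
Qed.

(** No induction over relaxations is needed: restrictions to proper subsets of [H] are unchanged and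
    uniform, so below [H] only the characteristic polynomials of the contractions change. *)
Lemma invKL_shift_exists k : exists q : {poly int},
  forall (T : finType) (M M' : matroid T) (H : {set T}),
    relaxed M H M' -> rank M = k -> invKL M' = invKL M + q.
Proof.
pose R n (u : {poly int}) := forall (T : finType) (M : matroid T),
    uniform k.-1 M -> #|ground M| = n -> invKL M = u.
have [u hu] : exists u, forall i, (i < k.+1)%N -> R i (u i).
  by apply: (exists_upto 0) => n _ _; apply: invKL_uniform.
(* Contracting [i < k] elements of [H] gives a relaxation by a set of size [k - i], which fixes the
   change of the characteristic polynomial. At [i = k] only [M] contributes, its contraction by [H]
   having rank one. *)
pose h i := if (i < k)%N
  then (-1) ^+ i * u i * revp (k - i) ((-1) ^+ (k - i) * (1 - 'X))
  else - ((-1) ^+ k.-1 * u i * revp 1 ('X - 1)).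
pose S := \sum_(i < k.+1) h i *+ 'C(k, i).
exists (lowp k ((-1) ^+ k * S)) => T M M' H rel rM.
have cH : #|H| = k by rewrite -(relaxed_rank rel).
have k0 : (0 < k)%N by rewrite -cH -(relaxed_rkH rel).
have rM' : rank M' = k by rewrite (relaxed_rank_eq rel).
suff <- : invKL M' - invKL M = lowp k ((-1) ^+ k * S) by rewrite [RHS]addrC subrK.
apply: lowp_unique => //.
  by apply: size_sub_half; rewrite -?rM' ?(invKL_spec T).1.2 ?rM' // -rM (invKL_spec T).1.2 ?rM.
have eg := relaxed_ground rel.
have nsub : ~~ (ground M \subset H).
  apply: contraNN (relaxed_neq_ground rel) => s.
  by rewrite eqEsubset s (relaxed_sub rel).
apply: (can_inj (signrMK k)); rewrite signrMK mulrBr revpB mulrBr.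
have := invKL_sum M; have := invKL_sum M'; rewrite rM rM' eg => -> ->.
rewrite (relaxed_sum_sub rel); last first.
  move=> F sF nFH nFE; rewrite (relaxed_contr_eq rel sF nFH).
  have [sHF|nHF] := boolP (H \subset F); last first.
    rewrite (relaxed_restr_eq rel sF nHF) (relaxed_rk_neq rel) //.
    by apply: contraNneq nFH => ->.
  rewrite charpoly_contr_nonflat ?revp0 ?mulr0 //; apply: nonflat_spanning => //.
  by apply: (relaxed_spanning rel) => //; rewrite properE sHF.
have -> : restr M' (ground M) = M' by rewrite -eg restr_ground.
have -> : rk M' (ground M) = k by rewrite -eg.
rewrite [rk M _]rM restr_ground (relaxed_contr_eq rel) ?subxx // subnn.
rewrite charpoly_ground0 ?ground_contr_ground //.
(* The ground set contributes [(-1) ^+ k] times the unknown difference, which cancels the one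
   subtracted on the left. *)
rewrite -[X in revp 0 X](expr0 'X) revpXn // subnn expr0 !mulr1 -!mulrBr addrK.
rewrite /S -cH -sum_powerset_card; apply: eq_bigr => F.
rewrite powersetE => sF; rewrite /h.
have sFE := subset_trans sF (relaxed_sub rel).
have uF : invKL (restr M F) = u #|F|.
  apply: (hu _ _ _ (restr M F)); first by rewrite ltnS -cH subset_leq_card.
    by rewrite -cH; apply: (relaxed_uniform rel).
  by rewrite /= (setIidPr sFE).
have [eF|nF] := eqVneq F H.
  rewrite {}eF in uF *.
  rewrite (@charpoly_contr_nonflat _ M') ?(relaxed_nonflat rel) ?eg ?(relaxed_sub rel) //.
  have rH := relaxed_rkH rel; rewrite cH in rH.
  rewrite revp0 mulr0 sub0r cH ltnn uF cH.
  rewrite charpoly_rank1 ?(relaxed_contr_rank1 rel) ?(relaxed_contr_loopless rel) //.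
  by have -> : (rk M H = k.-1)%N by [lia]; have -> : (k - k.-1 = 1)%N by lia.
have pF : F \proper H by rewrite properEneq nF.
have cF := proper_card pF; rewrite cH in cF.
rewrite (relaxed_rk_neq rel) // (relaxed_restr_eq rel) //; last first.
  by apply: contraNN nF => s; rewrite eqEsubset sF.
rewrite uF (relaxed_proper rel pF) cF -mulrBr -revpB cH; congr (_ * revp _ _).
rewrite (relaxed_charpoly (relaxed_contr rel pF)) cardsD (setIidPr sF) cH.
by rewrite addrC addKr.
Qed.
End Relaxation.

Theorem theorem3p6 (k : nat) (hk : (1 <= k)%N) :
  exists p q z : {poly int},
    forall (T : finType) (M M' : matroid T) (H : {set T}),
      rank M = k -> circuit_hyperplane M H -> is_relaxation M H M' ->
      [/\ KL M' = KL M + p, invKL M' = invKL M + q & Zpoly M' = Zpoly M + z].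
Proof.
have [p hp] := KL_shift_exists k; have [q hq] := invKL_shift_exists k.
have [z hz] := Zpoly_shift_exists k.
exists (p k), q, z => T M M' H rM cH rMH.
have rel := relaxation_relaxed cH rMH.
split; [exact: hp rel rM | exact: hq rel rM | exact: hz rel rM].
Qed.
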